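(* Let $$L(z)=s_0\sigma_0+\frac{s_1}{\pi\imath}\sigma_1e^{\pi\imath z}\phi\left(\tfrac\tau2,z\right)+\frac{s_2}{\pi\imath}\sigma_2e^{\pi\imath z}\phi\left(\tfrac{1+\tau}2,z\right)+\frac{s_3}{\pi\imath}\sigma_3\phi\left(\tfrac12,z\right)$$ be Sklyanin's Lax matrix, and let $\{\cdot,\cdot\}_1,\{\cdot,\cdot\}_2,\{\cdot,\cdot\}_3$ be the brackets on functions of $(s_0,s_1,s_2,s_3)$ given by (linear) $\{s_1,s_2\}_1=-s_3$, $\{s_1,s_3\}_1=s_2$, $\{s_2,s_3\}_1=-s_1$, $\{s_0,s_i\}_1=0$ for $i=1,2,3$; (quadratic) $\{s_0,s_1\}_2=-\theta_{01}^4s_2s_3$, $\{s_0,s_2\}_2=\theta_{00}^4s_1s_3$, $\{s_0,s_3\}_2=-\theta_{10}^4s_1s_2$, $\{s_1,s_2\}_2=-s_0s_3$, $\{s_1,s_3\}_2=s_0s_2$, $\{s_2,s_3\}_2=-s_0s_1$; (cubic) $\{s_0,s_1\}_3=-2\theta_{01}^4s_0s_2s_3$, $\{s_0,s_2\}_3=2\theta_{00}^4s_0s_1s_3$, $\{s_0,s_3\}_3=-2\theta_{10}^4s_0s_1s_2$, $\{s_1,s_2\}_3=s_3(s_1^2\theta_{00}^4+s_2^2\theta_{01}^4-s_0^2)$, $\{s_1,s_3\}_3=s_2(s_0^2-s_1^2\theta_{10}^4+s_3^2\theta_{01}^4)$, $\{s_2,s_3\}_3=-s_1(s_0^2+s_2^2\theta_{10}^4+s_3^2\theta_{00}^4)$.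 Then $$\{L(u)\stackrel\otimes,L(v)\}_3=\tfrac12\left[\{L(u)\stackrel\otimes,L(v)\}_2,\ L(u)\otimes\sigma_0+\sigma_0\otimes L(v)-s_0\,\sigma_0\otimes\sigma_0\right]_+$$ and $$\{L(u)\stackrel\otimes,L(v)\}_2=\tfrac12\left[\{L(u)\stackrel\otimes,L(v)\}_1,\ L(u)\otimes\sigma_0+\sigma_0\otimes L(v)-s_0\,\sigma_0\otimes\sigma_0\right]_+,$$ where $[A,B]_+=AB+BA$.
   Context: Theta functions follow Mumford: $\theta_{ab}(z|\tau)=\sum_{n\in\mathbb Z}\exp\left(\pi\imath(n+\tfrac a2)^2\tau+2\pi\imath(n+\tfrac a2)(z+\tfrac b2)\right)$, $a,b\in\{0,1\}$, $\operatorname{Im}\tau>0$; $\theta_{ab}=\theta_{ab}(0|\tau)$. Also $\phi(w,z)=\dfrac{\theta_{11}(w+z|\tau)\,\theta_{11}'(0|\tau)}{\theta_{11}(w|\tau)\,\theta_{11}(z|\tau)}$. $\sigma_0$ is the $2\times2$ identity matrix and $\sigma_1=\begin{pmatrix}0&1\\1&0\end{pmatrix}$, $\sigma_2=\begin{pmatrix}0&-\imath\\\imath&0\end{pmatrix}$, $\sigma_3=\begin{pmatrix}1&0\\0&-1\end{pmatrix}$. Brackets are skew-symmetric biderivations, and $u,v$ are spectral parameters (constants). For $A=\sum_aA_aE_a$, $B=\sum_bB_bE_b$ with constant matrices $E_a$, $\{A\stackrel\otimes,B\}=\sum_{a,b}\{A_a,B_b\}E_a\otimes E_b$. *)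

(* Defs.v *)
(* The complex numbers are R[i] for R : realType. *)
From HB Require Import structures.
From mathcomp Require Import all_boot all_order all_algebra.
From mathcomp Require Import complex mxtens.
From mathcomp Require Import all_classical all_reals all_analysis.
Set Implicit Arguments.
Unset Strict Implicit.
Unset Printing Implicit Defensive.

Import Order.TTheory GRing.Theory Num.Theory.
Import numFieldNormedType.Exports.

Local Open Scope classical_set_scope.
Local Open Scope ring_scope.
Local Open Scope complex_scope.

Section Theta.
Variable R : realType.
(* R[i] seen as a numFieldType, so that C^o carries the norm topology of the
   complex plane; derive1 over C is then the complex derivative. *)
Let C : numFieldType := R[i].

Definition Cexp (z : R[i]) : R[i] :=
  (expR (complex.Re z))%:C * (cos (complex.Im z) +i* sin (complex.Im z)).

Definition Cpi : R[i] := (pi : R)%:C.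

(* Bilateral sum, as the sum of the two one-sided series.  [limn] is a total
   operator; the theta series below converge absolutely when Im tau > 0. *)
Definition zsum (f : int -> R[i]) : R[i] :=
  limn (fun N => \sum_(0 <= n < N) f (Posz n) : C^o) +
  limn (fun N => \sum_(0 <= n < N) f (Negz n) : C^o).

Definition theta (a b : nat) (z tau : R[i]) : R[i] :=
  zsum (fun n : int =>
    Cexp (Cpi * 'i * (n%:~R + a%:R / 2) ^+ 2 * tau
          + 2 * Cpi * 'i * (n%:~R + a%:R / 2) * (z + b%:R / 2))).

Definition theta0 (a b : nat) (tau : R[i]) : R[i] := theta a b 0 tau.

Definition dtheta11 (tau : R[i]) : R[i] :=
  derive1 (fun z : C => theta 1 1 z tau : C^o) 0.

(* Meaningful when theta 1 1 w tau and theta 1 1 z tau are nonzero. *)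
Definition phi (tau w z : R[i]) : R[i] :=
  theta 1 1 (w + z) tau * dtheta11 tau / (theta 1 1 w tau * theta 1 1 z tau).

Definition mx2 (a b c d : R[i]) : 'M[R[i]]_2 :=
  \matrix_(i < 2, j < 2)
    (if i == 0 then (if j == 0 then a else b) else (if j == 0 then c else d)).

Definition sigma0 : 'M[R[i]]_2 := 1%:M.
Definition sigma1 : 'M[R[i]]_2 := mx2 0 1 1 0.
Definition sigma2 : 'M[R[i]]_2 := mx2 0 (- 'i) 'i 0.
Definition sigma3 : 'M[R[i]]_2 := mx2 1 0 0 (- 1).

End Theta.

(* A commutative C-algebra A plays the role of the algebra of functions of
   (s_0, s_1, s_2, s_3); the constants are the scalars k%:A. *)
Section Brackets.
Variables (R : realType) (A : comAlgType R[i]).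
Implicit Types (br : A -> A -> A) (M N : 'M[A]_2).

Definition constmx m n (E : 'M[R[i]]_(m, n)) : 'M[A]_(m, n) :=
  map_mx (fun k => k%:A) E.

Definition skew_biderivation br : Prop :=
  [/\ forall f g, br f g = - br g f,
      forall (k : R[i]) f g h, br (k *: f + g) h = k *: br f h + br g h &
      forall f g h, br (f * g) h = f * br g h + br f h * g].

Definition linear_bracket br (s0 s1 s2 s3 : A) : Prop :=
  skew_biderivation br /\
  [/\ br s1 s2 = - s3,
      br s1 s3 = s2 &
      br s2 s3 = - s1] /\
  [/\ br s0 s1 = 0,
      br s0 s2 = 0 &
      br s0 s3 = 0].

Definition quadratic_bracket (tau : R[i]) br (s0 s1 s2 s3 : A) : Prop :=
  skew_biderivation br /\
  [/\ br s0 s1 = - (theta0 0 1 tau ^+ 4 *: (s2 * s3)),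
      br s0 s2 = theta0 0 0 tau ^+ 4 *: (s1 * s3) &
      br s0 s3 = - (theta0 1 0 tau ^+ 4 *: (s1 * s2))] /\
  [/\ br s1 s2 = - (s0 * s3),
      br s1 s3 = s0 * s2 &
      br s2 s3 = - (s0 * s1)].

Definition cubic_bracket (tau : R[i]) br (s0 s1 s2 s3 : A) : Prop :=
  skew_biderivation br /\
  [/\ br s0 s1 = - ((2 * theta0 0 1 tau ^+ 4) *: (s0 * s2 * s3)),
      br s0 s2 = (2 * theta0 0 0 tau ^+ 4) *: (s0 * s1 * s3) &
      br s0 s3 = - ((2 * theta0 1 0 tau ^+ 4) *: (s0 * s1 * s2))] /\
  [/\ br s1 s2 = s3 * (theta0 0 0 tau ^+ 4 *: s1 ^+ 2
                       + theta0 0 1 tau ^+ 4 *: s2 ^+ 2 - s0 ^+ 2),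
      br s1 s3 = s2 * (s0 ^+ 2 - theta0 1 0 tau ^+ 4 *: s1 ^+ 2
                       + theta0 0 1 tau ^+ 4 *: s3 ^+ 2) &
      br s2 s3 = - (s1 * (s0 ^+ 2 + theta0 1 0 tau ^+ 4 *: s2 ^+ 2
                          + theta0 0 0 tau ^+ 4 *: s3 ^+ 2))].

(* The expansion in the basis of matrix units; [tens_bracketE] below shows that
   any expansion in constant matrices gives the same result. *)
Definition tens_bracket br M N : 'M[A]_(2 * 2) :=
  \sum_(i < 2) \sum_(j < 2) \sum_(k < 2) \sum_(l < 2)
    br (M i j) (N k l) *: (delta_mx i j *t delta_mx k l).

Definition anticomm n (X Y : 'M[A]_n) : 'M[A]_n := X *m Y + Y *m X.

Definition Lax (tau : R[i]) (s0 s1 s2 s3 : A) (z : R[i]) : 'M[A]_2 :=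
  s0 *: constmx (sigma0 R)
  + s1 *: constmx ((Cexp (Cpi R * 'i * z) * phi tau (tau / 2) z / (Cpi R * 'i))
                   *: sigma1 R)
  + s2 *: constmx ((Cexp (Cpi R * 'i * z) * phi tau ((1 + tau) / 2) z
                    / (Cpi R * 'i)) *: sigma2 R)
  + s3 *: constmx ((phi tau (1 / 2) z / (Cpi R * 'i)) *: sigma3 R).

Lemma tens_bracketE br (I J : finType) (f : I -> A) (g : J -> A)
    (E : I -> 'M[R[i]]_2) (F : J -> 'M[R[i]]_2) :
  skew_biderivation br ->
  tens_bracket br (\sum_a f a *: constmx (E a)) (\sum_b g b *: constmx (F b)) =
  \sum_a \sum_b br (f a) (g b) *: (constmx (E a) *t constmx (F b)).
Proof.
case=> skew lin _.
have br0l h : br 0 h = 0.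
  by have := lin (-1) h h h; rewrite !scaleN1r !addNr.
have brsl (K : finType) (c : K -> R[i]) (p : K -> A) h :
    br (\sum_a c a *: p a) h = \sum_a c a *: br (p a) h.
  by elim/big_rec2: _ => [|a x y _ <-]; rewrite ?br0l ?lin.
have brsr (K : finType) (c : K -> R[i]) (p : K -> A) h :
    br h (\sum_a c a *: p a) = \sum_a c a *: br h (p a).
  rewrite skew brsl -sumrN; apply: eq_bigr => a _.
  by rewrite (skew h) scalerN.
have ent (K : finType) (p : K -> A) (G : K -> 'M[R[i]]_2) i j :
    (\sum_a p a *: constmx (G a)) i j = \sum_a G a i j *: p a.
  rewrite summxE; apply: eq_bigr => a _.
  by rewrite !mxE /= -scalerAr mulr1.
apply/matrixP => x y.
have [i0 [k0 ->]] : exists i k, x = mxtens_index (i, k).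
  by exists (mxtens_unindex x).1, (mxtens_unindex x).2;
    rewrite -surjective_pairing mxtens_unindexK.
have [j0 [l0 ->]] : exists i k, y = mxtens_index (i, k).
  by exists (mxtens_unindex y).1, (mxtens_unindex y).2;
    rewrite -surjective_pairing mxtens_unindexK.
transitivity (br ((\sum_a f a *: constmx (E a)) i0 j0)
                 ((\sum_b g b *: constmx (F b)) k0 l0)).
  rewrite /tens_bracket summxE (bigD1 i0) //= [X in _ + X]big1 ?addr0; last first.
    move=> i /negPf ni; rewrite summxE big1 // => j _; rewrite summxE big1 // => k _.
    rewrite summxE big1 // => l _.
    by rewrite mxE tensmxE !mxE eq_sym ni /= !mul0r mulr0.
  rewrite summxE (bigD1 j0) //= [X in _ + X]big1 ?addr0; last first.
    move=> j /negPf nj; rewrite summxE big1 // => k _; rewrite summxE big1 // => l _.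
    by rewrite mxE tensmxE !mxE (eq_sym j0) nj andbF /= !mul0r mulr0.
  rewrite summxE (bigD1 k0) //= [X in _ + X]big1 ?addr0; last first.
    move=> k /negPf nk; rewrite summxE big1 // => l _.
    by rewrite mxE tensmxE !mxE (eq_sym k0) nk /= !mulr0.
  rewrite summxE (bigD1 l0) //= [X in _ + X]big1 ?addr0; last first.
    move=> l /negPf nl.
    by rewrite mxE tensmxE !mxE (eq_sym l0) nl andbF /= !mulr0.
  by rewrite mxE tensmxE [delta_mx _ _ _ _]mxE [delta_mx _ _ _ _]mxE !eqxx !mulr1.
rewrite !ent brsl summxE; apply: eq_bigr => a _.
rewrite brsr summxE scaler_sumr; apply: eq_bigr => b _.
rewrite [in RHS]mxE tensmxE !mxE.
by rewrite -!scalerAl mul1r -!scalerAr mulr1 !scalerA mulrC.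
Qed.

End Brackets.

(* Main.v *)
Require Import Defs.
From mathcomp Require Import all_boot all_order all_algebra.
From mathcomp Require Import complex mxtens.
From mathcomp Require Import all_classical all_reals all_analysis.
From mathcomp Require Import ring lra zify.
Import Order.TTheory GRing.Theory Num.Theory.
Import numFieldNormedType.Exports.
Set Implicit Arguments.
Unset Strict Implicit.
Unset Printing Implicit Defensive.
Local Open Scope ring_scope.
Local Open Scope complex_scope.
Local Open Scope classical_set_scope.

(** Expanding both sides over the products of Pauli matrices, the two identities
    hold as soon as the coefficients w_1, w_2, w_3 of L satisfy, at u and at v,
      w_3^2 - w_2^2 = theta_01^4,  w_3^2 - w_1^2 = theta_00^4,
      w_2^2 - w_1^2 = theta_10^4.
    Rearranging the double series of a product of two theta functions along
    n + m even and n + m odd expresses the squares of the four theta functions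
    bilinearly in theta functions of 2 tau, which gives every quadratic relation
    needed.  The same rearrangement gives duplication formulas under which
    theta_11'(0) / (theta_00 theta_01 theta_10) is invariant by tau -> 2 tau;
    letting Im tau tend to infinity shows that it is - pi and that the theta
    constants do not vanish. *)

(** * Pauli tensors and the recursion between brackets *)

(** The brackets have fourth powers of theta constants as structure constants, whereas [phi] is
    normalised by theta_11'(0) and divided by theta_11 at a half period. The coefficients of L
    become quotients of theta functions only once that derivative is a product of theta constants
    and those half-period values are known to be nonzero. Both facts usually rest on the zeros of
    theta_11 or on the heat equation; here they rest only on manipulations of series, because
    doubling tau leads to the range where one or two terms dominate. The spectral parameters
    decouple: a component of the tensor identities uses the relations at u or those at v. The one
    exception is the component on sigma_0 tensor sigma_0 of the cubic identity, where both sets are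
    combined. *)

Lemma big_ord4 (V : nmodType) (F : nat -> V) :
  \sum_(a < 4) F a = F 0 + F 1 + F 2 + F 3.
Proof. by rewrite !big_ord_recl big_ord0 /= addr0 !addrA. Qed.

Section PauliAlgebra.
Variable A : comNzRingType.

(* [pauli 2] is 'i sigma_2, so that the basis is real and squares to
   1, 1, -1, 1. *)
Definition pauli (a : nat) : 'M[A]_2 :=
  \matrix_(i, j)
    match a with
    | 0 => (i == j)%:R
    | 1 => (i != j)%:R
    | 2 => if i == j then 0 else if i == 0 then 1 else -1
    | _ => if i != j then 0 else if i == 0 then 1 else -1
    end.

Definition pauli_comb (c : nat -> A) : 'M[A]_2 := \sum_(a < 4) c a *: pauli a.

Definition pauli_tens (C : nat -> nat -> A) : 'M[A]_(2 * 2) :=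
  \sum_(a < 4) \sum_(b < 4) C a b *: (pauli a *t pauli b).

(** The Jordan product, half the anticommutator, in the coordinates of [pauli]: distinct traceless
    basis matrices anticommute, so only their squares and the products with the identity survive. *)
Definition jordan (c m : nat -> A) (a : nat) : A :=
  if a == 0 then c 0 * m 0 + c 1 * m 1 - c 2 * m 2 + c 3 * m 3
  else c 0 * m a + m 0 * c a.

Lemma pauli_comb_entry c (i j : 'I_2) :
  pauli_comb c i j =
  if i == j then c 0 + (if i == 0 then 1 else -1) * c 3
  else c 1 + (if i == 0 then 1 else -1) * c 2.
Proof.
rewrite summxE !big_ord_recl big_ord0 !mxE /=.
by case: i => -[|[|//]] ?; case: j => -[|[|//]] ? /=; ring.
Qed.

Lemma anticomm_pauli_comb c m :
  pauli_comb c *m pauli_comb m + pauli_comb m *m pauli_comb c =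
  2 *: pauli_comb (jordan c m).
Proof.
apply/matrixP => i j; rewrite !mxE !big_ord_recl !big_ord0 !pauli_comb_entry.
by case: i => -[|[|//]] ?; case: j => -[|[|//]] ?; rewrite /jordan /=; ring.
Qed.

Lemma tensmx_suml m n p q I (r : seq I) (F : I -> 'M[A]_(m, n)) (N : 'M[A]_(p, q)) :
  (\sum_(i <- r) F i) *t N = \sum_(i <- r) (F i *t N).
Proof.
apply/matrixP => x y; case: (mxtens_indexP x) => ??; case: (mxtens_indexP y) => ??.
by rewrite tensmxE !summxE mulr_suml; apply: eq_bigr => i _; rewrite tensmxE.
Qed.

Lemma tensmx_sumr m n p q I (r : seq I) (F : I -> 'M[A]_(p, q)) (M : 'M[A]_(m, n)) :
  M *t (\sum_(i <- r) F i) = \sum_(i <- r) (M *t F i).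
Proof.
apply/matrixP => x y; case: (mxtens_indexP x) => ??; case: (mxtens_indexP y) => ??.
by rewrite tensmxE !summxE mulr_sumr; apply: eq_bigr => i _; rewrite tensmxE.
Qed.

Lemma tensmxZl m n p q a (M : 'M[A]_(m, n)) (N : 'M[A]_(p, q)) :
  (a *: M) *t N = a *: (M *t N).
Proof.
apply/matrixP => x y; case: (mxtens_indexP x) => ??; case: (mxtens_indexP y) => ??.
by rewrite [RHS]mxE !tensmxE mxE mulrA.
Qed.

Lemma tensmxZr m n p q a (M : 'M[A]_(m, n)) (N : 'M[A]_(p, q)) :
  M *t (a *: N) = a *: (M *t N).
Proof.
apply/matrixP => x y; case: (mxtens_indexP x) => ??; case: (mxtens_indexP y) => ??.
by rewrite [RHS]mxE !tensmxE mxE mulrCA.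
Qed.

Lemma tensmxDl m n p q (M M' : 'M[A]_(m, n)) (N : 'M[A]_(p, q)) :
  (M + M') *t N = M *t N + M' *t N.
Proof.
apply/matrixP => x y; case: (mxtens_indexP x) => ??; case: (mxtens_indexP y) => ??.
by rewrite [RHS]mxE !tensmxE mxE mulrDl.
Qed.

Lemma tensmxDr m n p q (M : 'M[A]_(m, n)) (N N' : 'M[A]_(p, q)) :
  M *t (N + N') = M *t N + M *t N'.
Proof.
apply/matrixP => x y; case: (mxtens_indexP x) => ??; case: (mxtens_indexP y) => ??.
by rewrite [RHS]mxE !tensmxE mxE mulrDr.
Qed.

Lemma tensmx11 m n : (1%:M : 'M[A]_m) *t (1%:M : 'M[A]_n) = 1%:M.
Proof.
apply/matrixP => x y; case: (mxtens_indexP x) => ??; case: (mxtens_indexP y) => ??.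
rewrite tensmxE !mxE (inj_eq (can_inj (@mxtens_indexK m n))) xpair_eqE.
by rewrite -natrM mulnb.
Qed.

Lemma pauli_tensEr C :
  pauli_tens C = \sum_(a < 4) (pauli a *t pauli_comb (C a)).
Proof.
apply: eq_bigr => a _; rewrite tensmx_sumr; apply: eq_bigr => b _.
by rewrite tensmxZr.
Qed.

Lemma pauli_tensEl C :
  pauli_tens C = \sum_(b < 4) (pauli_comb (C^~ b) *t pauli b).
Proof.
rewrite /pauli_tens exchange_big; apply: eq_bigr => b _ /=.
by rewrite tensmx_suml; apply: eq_bigr => a _; rewrite tensmxZl.
Qed.

(** Each summand of [S] acts on one tensor leg only. Expanding [X] along the other leg reduces its
    anticommutator with that summand to the 2 x 2 case. *)
Lemma anticomm_pauli_tens (C : nat -> nat -> A) (s : A) (P Q : nat -> A) :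
  let X := pauli_tens C in
  let S := pauli_comb P *t 1%:M + 1%:M *t pauli_comb Q - s *: (1%:M *t 1%:M) in
  X *m S + S *m X =
  2 *: pauli_tens (fun a b => jordan (C^~ b) P a + jordan (C a) Q b - s * C a b).
Proof.
move=> X S.
have -> : X *m S + S *m X =
    (X *m (pauli_comb P *t 1%:M) + (pauli_comb P *t 1%:M) *m X)
  + (X *m (1%:M *t pauli_comb Q) + (1%:M *t pauli_comb Q) *m X)
  - (2 * s) *: X.
  rewrite /S tensmx11.
  rewrite !mulmxBr !mulmxBl !mulmxDr !mulmxDl -!scalemxAl -!scalemxAr.
  rewrite mulmx1 mul1mx -scalerA [2 *: _]scaler_nat mulr2n.
  set x := _ *m _; set y := _ *m _; set z := _ *m _; set t := _ *m _.
  by rewrite opprD addrACA; congr (_ + _); rewrite addrACA.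
have -> : X *m (pauli_comb P *t 1%:M) + (pauli_comb P *t 1%:M) *m X =
    2 *: pauli_tens (fun a b => jordan (C^~ b) P a).
  rewrite /X [in RHS]pauli_tensEl [pauli_tens C]pauli_tensEl.
  rewrite mulmx_suml mulmx_sumr -big_split scaler_sumr; apply: eq_bigr => b _ /=.
  by rewrite !tensmx_mul mulmx1 mul1mx -tensmxDl anticomm_pauli_comb tensmxZl.
have -> : X *m (1%:M *t pauli_comb Q) + (1%:M *t pauli_comb Q) *m X =
    2 *: pauli_tens (fun a b => jordan (C a) Q b).
  rewrite /X [in RHS]pauli_tensEr [pauli_tens C]pauli_tensEr.
  rewrite mulmx_suml mulmx_sumr -big_split scaler_sumr; apply: eq_bigr => b _ /=.
  by rewrite !tensmx_mul mulmx1 mul1mx -tensmxDr anticomm_pauli_comb tensmxZr.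
rewrite -scalerA -scalerDr -scalerBr; congr (_ *: _).
rewrite /X /pauli_tens scaler_sumr -big_split -sumrB; apply: eq_bigr => a _ /=.
rewrite scaler_sumr -big_split -sumrB; apply: eq_bigr => b _ /=.
by rewrite scalerA -scalerDl -scalerBl.
Qed.

(** * From one bracket to the next, in coordinates; [p] and [q] stand for the Lax coefficients at u
    and v *)

Section Recursion.
Variables (br1 br2 br3 : A -> A -> A) (s0 s1 s2 s3 t01 t00 t10 : A) (p q : nat -> A).
Let s a := nth 0 [:: s0; s1; s2; s3] a.
Let C br a b : A := br (s a) (s b) * (p a * q b).
Hypotheses (p0 : p 0 = 1) (q0 : q 0 = 1).
Hypotheses (p01 : t01 = p 3 ^+ 2 + p 2 ^+ 2) (p00 : t00 = p 3 ^+ 2 - p 1 ^+ 2)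
  (p10 : t10 = - p 2 ^+ 2 - p 1 ^+ 2).
Hypotheses (q01 : t01 = q 3 ^+ 2 + q 2 ^+ 2) (q00 : t00 = q 3 ^+ 2 - q 1 ^+ 2)
  (q10 : t10 = - q 2 ^+ 2 - q 1 ^+ 2).
Hypotheses (skew2 : forall f g, br2 f g = - br2 g f) (diag2 : forall f, br2 f f = 0).
Hypotheses (b201 : br2 s0 s1 = - (t01 * (s2 * s3)))
  (b202 : br2 s0 s2 = t00 * (s1 * s3)) (b203 : br2 s0 s3 = - (t10 * (s1 * s2)))
  (b212 : br2 s1 s2 = - (s0 * s3)) (b213 : br2 s1 s3 = s0 * s2)
  (b223 : br2 s2 s3 = - (s0 * s1)).

(** The relations enter only when exactly one index is 0: those on [p] for (0, b), those on [q] for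
    (a, 0). If both indices are positive, each Jordan product contributes s0 times the linear
    bracket, and the term in [- s0] removes one of the two copies. *)
Lemma quadratic_from_linear a b :
  (forall f g, br1 f g = - br1 g f) -> (forall f, br1 f f = 0) ->
  br1 s1 s2 = - s3 -> br1 s1 s3 = s2 -> br1 s2 s3 = - s1 ->
  br1 s0 s1 = 0 -> br1 s0 s2 = 0 -> br1 s0 s3 = 0 ->
  (a < 4)%N -> (b < 4)%N ->
  C br2 a b = jordan ((C br1)^~ b) (fun a => s a * p a) a
    + jordan (C br1 a) (fun b => s b * q b) b - s0 * C br1 a b.
Proof.
move=> sk1 d1 b112 b113 b123 b101 b102 b103; rewrite /jordan /C /s.
case: a => [|[|[|[|//]]]] _; case: b => [|[|[|[|//]]]] _ /=; rewrite ?p0 ?q0;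
rewrite ?(sk1 s1 s0) ?(sk1 s2 s0) ?(sk1 s3 s0) ?(sk1 s2 s1) ?(sk1 s3 s1) ?(sk1 s3 s2);
rewrite ?(skew2 s1 s0) ?(skew2 s2 s0) ?(skew2 s3 s0) ?(skew2 s2 s1) ?(skew2 s3 s1) ?(skew2 s3 s2);
rewrite ?d1 ?diag2 ?b112 ?b113 ?b123 ?b101 ?b102 ?b103 ?b201 ?b202 ?b203 ?b212 ?b213 ?b223;
by [ring|rewrite p01; ring|rewrite p00; ring|rewrite p10; ring
   |rewrite q01; ring|rewrite q00; ring|rewrite q10; ring].
Qed.

Lemma cubic_from_quadratic a b :
  (forall f g, br3 f g = - br3 g f) -> (forall f, br3 f f = 0) ->
  br3 s0 s1 = - (2 * (t01 * (s0 * s2 * s3))) ->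
  br3 s0 s2 = 2 * (t00 * (s0 * s1 * s3)) ->
  br3 s0 s3 = - (2 * (t10 * (s0 * s1 * s2))) ->
  br3 s1 s2 = s3 * (t00 * s1 ^+ 2 + t01 * s2 ^+ 2 - s0 ^+ 2) ->
  br3 s1 s3 = s2 * (s0 ^+ 2 - t10 * s1 ^+ 2 + t01 * s3 ^+ 2) ->
  br3 s2 s3 = - (s1 * (s0 ^+ 2 + t10 * s2 ^+ 2 + t00 * s3 ^+ 2)) ->
  (a < 4)%N -> (b < 4)%N ->
  C br3 a b = jordan ((C br2)^~ b) (fun a => s a * p a) a
    + jordan (C br2 a) (fun b => s b * q b) b - s0 * C br2 a b.
Proof.
move=> sk3 d3 b301 b302 b303 b312 b313 b323; rewrite /jordan /C /s.
(* Needed for the component (0, 0), whose left side is [br3 s0 s0 = 0]. The relations make the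
   differences of squares equal for the indices 1 and 3 and opposite for 2, so the sum is a multiple
   of t00 - t01 - t10, and this vanishes: it is Jacobi's quartic identity. *)
have zero : - t01 * (q 1 ^+ 2 - p 1 ^+ 2) - t00 * (q 2 ^+ 2 - p 2 ^+ 2)
            - t10 * (q 3 ^+ 2 - p 3 ^+ 2) = 0.
  have -> : q 3 ^+ 2 = t00 + q 1 ^+ 2 by rewrite q00; ring.
  have -> : q 2 ^+ 2 = - t10 - q 1 ^+ 2 by rewrite q10; ring.
  by rewrite p01 p00 p10; ring.
case: a => [|[|[|[|//]]]] _; case: b => [|[|[|[|//]]]] _ /=; rewrite ?p0 ?q0;
rewrite ?(sk3 s1 s0) ?(sk3 s2 s0) ?(sk3 s3 s0) ?(sk3 s2 s1) ?(sk3 s3 s1) ?(sk3 s3 s2);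
rewrite ?(skew2 s1 s0) ?(skew2 s2 s0) ?(skew2 s3 s0) ?(skew2 s2 s1) ?(skew2 s3 s1) ?(skew2 s3 s2);
rewrite ?d3 ?diag2 ?b312 ?b313 ?b323 ?b301 ?b302 ?b303 ?b201 ?b202 ?b203 ?b212 ?b213 ?b223.
  apply/eqP; rewrite -subr_eq0; apply/eqP.
  by transitivity (- (s1 * s2 * s3) * (- t01 * (q 1 ^+ 2 - p 1 ^+ 2)
    - t00 * (q 2 ^+ 2 - p 2 ^+ 2) - t10 * (q 3 ^+ 2 - p 3 ^+ 2)));
    [ring|rewrite zero mulr0].
all: by [ring|rewrite p01; ring|rewrite p00; ring|rewrite p10; ring
   |rewrite q01; ring|rewrite q00; ring|rewrite q10; ring].
Qed.
End Recursion.

End PauliAlgebra.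

(** * The Lax matrix in Pauli coordinates *)

Section Brackets.
Variables (R : realType) (A : comAlgType R[i]).

(** Coordinates with respect to [pauli]. Since sigma_2 is [- 'i] times [pauli 2], the square of
    coordinate 2 is minus the square of the coefficient of sigma_2, which accounts for the signs in
    the relations below. *)
Definition lax_coef (tau z : R[i]) (a : nat) : R[i] :=
  nth 0 [:: 1; Cexp (Cpi R * 'i * z) * phi tau (tau / 2) z / (Cpi R * 'i);
    - 'i * (Cexp (Cpi R * 'i * z) * phi tau ((1 + tau) / 2) z / (Cpi R * 'i));
    phi tau (1 / 2) z / (Cpi R * 'i)] a.

Lemma LaxE tau (s0 s1 s2 s3 : A) z :
  Lax tau s0 s1 s2 s3 z =
  \sum_(a < 4) nth 0 [:: s0; s1; s2; s3] a *: constmx A (lax_coef tau z a *: pauli R[i] a).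
Proof.
rewrite /Lax /lax_coef; move: (Cexp _ * _ / _) (Cexp _ * _ / _) (phi _ _ _ / _).
move=> k2 k1 k3.
have -> : sigma0 R = 1 *: pauli R[i] 0.
  by rewrite scale1r; apply/matrixP => i j; rewrite !mxE.
have -> : k1 *: sigma1 R = k1 *: pauli R[i] 1.
  by apply/matrixP => i j; rewrite !mxE;
    case: i => -[|[|//]] ?; case: j => -[|[|//]] ?.
have -> : k2 *: sigma2 R = (- 'i * k2) *: pauli R[i] 2.
  apply/matrixP => i j; rewrite !mxE.
  by case: i => -[|[|//]] ?; case: j => -[|[|//]] ? /=; rewrite -?complexiE; ring.
have -> : k3 *: sigma3 R = k3 *: pauli R[i] 3.
  by apply/matrixP => i j; rewrite !mxE;
    case: i => -[|[|//]] ?; case: j => -[|[|//]] ?.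
by rewrite (big_ord4 (fun a => nth 0 [:: s0; s1; s2; s3] a *:
  constmx A (nth 0 [:: 1; k1; - 'i * k2; k3] a *: pauli R[i] a))).
Qed.

Lemma constmx_pauli k a : constmx A (k *: pauli R[i] a) = k%:A *: pauli A a.
Proof.
apply/matrixP => i j; rewrite !mxE.
by case: a => [|[|[|a]]]; case: i => -[|[|//]] ?; case: j => -[|[|//]] ? /=;
  rewrite ?mulr0 ?scale0r ?mulrN1 ?scaleNr ?mulr1.
Qed.

Lemma Lax_pauli tau (s0 s1 s2 s3 : A) z :
  Lax tau s0 s1 s2 s3 z =
  pauli_comb (fun a => nth 0 [:: s0; s1; s2; s3] a * (lax_coef tau z a)%:A).
Proof.
rewrite LaxE; apply: eq_bigr => a _; rewrite constmx_pauli scalerA //.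
Qed.

Lemma tens_bracket_Lax br tau (s0 s1 s2 s3 : A) u v : skew_biderivation br ->
  tens_bracket br (Lax tau s0 s1 s2 s3 u) (Lax tau s0 s1 s2 s3 v) =
  pauli_tens (fun a b => br (nth 0 [:: s0; s1; s2; s3] a) (nth 0 [:: s0; s1; s2; s3] b)
     * ((lax_coef tau u a)%:A * (lax_coef tau v b)%:A)).
Proof.
move=> hb; rewrite !LaxE tens_bracketE //.
apply: eq_bigr => a _; apply: eq_bigr => b _.
by rewrite !constmx_pauli tensmxZl tensmxZr !scalerA.
Qed.

Lemma skew_bracket_diag (br : A -> A -> A) f : skew_biderivation br -> br f f = 0.
Proof.
case=> sk _ _; have /eqP := sk f f; rewrite -subr_eq0 opprK -mulr2n -scaler_nat.
move=> /eqP h.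
have : (2^-1 : R[i]) *: ((2 : R[i]) *: br f f) = 0.
  by rewrite scaler_nat -scaler_nat h scaler0.
by rewrite scalerA mulVf ?scale1r // pnatr_eq0.
Qed.

Lemma pauli_tens_recursion (C C' : nat -> nat -> A) (s : A) (P Q : nat -> A) :
  (forall a b, (a < 4)%N -> (b < 4)%N ->
     C' a b = jordan (C^~ b) P a + jordan (C a) Q b - s * C a b) ->
  pauli_tens C' = (1 / 2 : R[i])%:A *:
    anticomm (pauli_tens C)
      (pauli_comb P *t 1%:M + 1%:M *t pauli_comb Q - s *: (1%:M *t 1%:M)).
Proof.
move=> CE; rewrite /anticomm anticomm_pauli_tens scalerA.
have -> : (1 / 2 : R[i])%:A * 2 = 1 :> A.
  by rewrite mulr_algl -[2 : A]scaler_nat scalerA div1r mulVf ?scale1r ?pnatr_eq0.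
rewrite scale1r; apply: eq_bigr => a _; apply: eq_bigr => b _.
by rewrite -CE.
Qed.

Lemma Lax_recursion (s0 s1 s2 s3 : A) (br1 br2 br3 : A -> A -> A) (tau u v : R[i]) :
  linear_bracket br1 s0 s1 s2 s3 ->
  quadratic_bracket tau br2 s0 s1 s2 s3 ->
  cubic_bracket tau br3 s0 s1 s2 s3 ->
  (forall z, z = u \/ z = v ->
    [/\ theta0 0 1 tau ^+ 4 = lax_coef tau z 3 ^+ 2 + lax_coef tau z 2 ^+ 2,
        theta0 0 0 tau ^+ 4 = lax_coef tau z 3 ^+ 2 - lax_coef tau z 1 ^+ 2 &
        theta0 1 0 tau ^+ 4 = - lax_coef tau z 2 ^+ 2 - lax_coef tau z 1 ^+ 2]) ->
  let L := Lax tau s0 s1 s2 s3 in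
  let I2 := constmx A (sigma0 R) in
  let S := L u *t I2 + I2 *t L v - s0 *: (I2 *t I2) in
  tens_bracket br3 (L u) (L v)
    = (1 / 2 : R[i])%:A *: anticomm (tens_bracket br2 (L u) (L v)) S
  /\
  tens_bracket br2 (L u) (L v)
    = (1 / 2 : R[i])%:A *: anticomm (tens_bracket br1 (L u) (L v)) S.
Proof.
move=> [b1 [[b112 b113 b123] [b101 b102 b103]]].
move=> [b2 [[b201 b202 b203] [b212 b213 b223]]].
move=> [b3 [[b301 b302 b303] [b312 b313 b323]]] theta_lax L I2 S.
have I2E : I2 = 1%:M.
  by apply/matrixP => i j; rewrite !mxE; case: (i == j); rewrite ?scale1r ?scale0r.
rewrite /S I2E /L !tens_bracket_Lax // !Lax_pauli.
have [Tu01 Tu00 Tu10] := theta_lax u (or_introl erefl).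
have [Tv01 Tv00 Tv10] := theta_lax v (or_intror erefl).
have skewd (br : A -> A -> A) : skew_biderivation br ->
    (forall f g, br f g = - br g f) /\ (forall f, br f f = 0).
  move=> hb; split; first by case: hb.
  move=> f; exact: (skew_bracket_diag f hb).
have [sk1 d1] := skewd _ b1; have [sk2 d2] := skewd _ b2; have [sk3 d3] := skewd _ b3.
have pu0 : (lax_coef tau u 0)%:A = 1 :> A by rewrite scale1r.
have pv0 : (lax_coef tau v 0)%:A = 1 :> A by rewrite scale1r.
clear theta_lax I2E b1 b2 b3 skewd S I2 L.
move: (theta0 0 1 tau ^+ 4) (theta0 0 0 tau ^+ 4) (theta0 1 0 tau ^+ 4)
  b201 b202 b203 b301 b302 b303 b312 b313 b323 Tu01 Tu00 Tu10 Tv01 Tv00 Tv10 pu0 pv0.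
move: (lax_coef tau u) (lax_coef tau v) => p q t01 t00 t10.
move=> b201 b202 b203 b301 b302 b303 b312 b313 b323 Tu01 Tu00 Tu10 Tv01 Tv00 Tv10 pu0 pv0.
(* Scalars are moved into [A], so that everything becomes an identity in one commutative ring. *)
have scA k x : k *: x = k%:A * x :> A by rewrite mulr_algl.
have sc2A k x : (2 * k) *: x = 2 * (k%:A * x) :> A.
  by rewrite -scalerA scaler_nat mulr_algl mulr_natl.
rewrite scA in b201; rewrite scA in b202; rewrite scA in b203.
rewrite sc2A in b301; rewrite sc2A in b302; rewrite sc2A in b303.
rewrite (scA t00) (scA t01) in b312; rewrite (scA t10) (scA t01) in b313.
rewrite (scA t10) (scA t00) in b323.
have alg2 x y a b : x = a ^+ 2 + b ^+ 2 -> y = a ^+ 2 - b ^+ 2 ->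
    x%:A = a%:A ^+ 2 + b%:A ^+ 2 :> A /\ y%:A = a%:A ^+ 2 - b%:A ^+ 2 :> A.
  move=> -> ->; rewrite -!(rmorphXn (in_alg A)).
  by split; [exact: (rmorphD (in_alg A))|exact: (rmorphB (in_alg A))].
have algN x a b : x = - a ^+ 2 - b ^+ 2 -> x%:A = - a%:A ^+ 2 - b%:A ^+ 2 :> A.
  move=> ->; rewrite -!(rmorphXn (in_alg A)) -(rmorphN (in_alg A)).
  exact: (rmorphB (in_alg A)).
(* Each call keeps one conclusion of [alg2]; [erefl] fills in the equation for the other. *)
have [Au01 _] := alg2 _ _ _ _ Tu01 erefl; have [_ Au00] := alg2 _ _ _ _ erefl Tu00.
have [Av01 _] := alg2 _ _ _ _ Tv01 erefl; have [_ Av00] := alg2 _ _ _ _ erefl Tv00.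
have Au10 := algN _ _ _ Tu10; have Av10 := algN _ _ _ Tv10.
by split; apply: pauli_tens_recursion => a b a4 b4;
  [apply: (@cubic_from_quadratic A br2 br3 s0 s1 s2 s3 t01%:A t00%:A t10%:A
     (fun a => (p a)%:A) (fun a => (q a)%:A))|
   apply: (@quadratic_from_linear A br1 br2 s0 s1 s2 s3 t01%:A t00%:A t10%:A
     (fun a => (p a)%:A) (fun a => (q a)%:A))].
Qed.

End Brackets.

(** * Bilateral series *)

Section ComplexSequences.
Variable R : realType.
Let C : numFieldType := R[i].
Implicit Types (u v : nat -> R[i]) (x y z : R[i]).

(** Norms on [R[i]] take values in [R[i]], so every epsilon is a complex number; being positive, it
    is real. *)
Lemma complex_pos (e : R[i]) : 0 < e -> exists2 d : R, 0 < d & e = d%:C.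
Proof.
case: e => a b; rewrite ltcE /= => /andP[/eqP -> a0]; by exists a.
Qed.

Lemma real_complexM (a b : R) : (a * b)%:C = a%:C * b%:C :> R[i].
Proof. exact: rmorphM. Qed.

Lemma real_complexD (a b : R) : (a + b)%:C = a%:C + b%:C :> R[i].
Proof. exact: rmorphD. Qed.

Lemma norm_le_ReIm x : `|x| <= (`|complex.Re x| + `|complex.Im x|)%:C.
Proof.
rewrite [x in X in X <= _]complexE (le_trans (ler_normD _ _)) //.
have -> : `|'i%C * (complex.Im x)%:C| = `|(complex.Im x)%:C|.
  by rewrite normrM [`|'i%C|]normc_def /= expr0n /= add0r expr1n sqrtr1 mul1r.
by rewrite !normc_def /= expr0n /= !addr0 !sqrtr_sqr rmorphD.
Qed.

Lemma Re_le_norm x : `|complex.Re x|%:C <= `|x|.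
Proof. exact: normc_ge_Re. Qed.

Lemma Im_le_norm x : `|complex.Im x|%:C <= `|x|.
Proof.
rewrite normc_def lecR -sqrtr_sqr ler_wsqrtr //.
by rewrite lerDr sqr_ge0.
Qed.

Lemma cvg_complex u (a b : R) :
  (complex.Re (u n) @[n --> \oo] --> a) -> (complex.Im (u n) @[n --> \oo] --> b) ->
  (u n : C^o) @[n --> \oo] --> ((a +i* b)%C : C^o).
Proof.
move=> ua ub; apply/cvgrPdist_le => e /complex_pos[d d0 ->].
have d2 : 0 < d / 2 by rewrite divr_gt0.
move/cvgrPdist_le : ua => /(_ _ d2) ua; move/cvgrPdist_le : ub => /(_ _ d2) ub.
near=> n; apply: le_trans (norm_le_ReIm _) _.
rewrite lecR [d]splitr lerD //.
  have -> : complex.Re ((a +i* b)%C - u n) = a - complex.Re (u n).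
    by case: (u n).
  by near: n.
have -> : complex.Im ((a +i* b)%C - u n) = b - complex.Im (u n).
  by case: (u n).
by near: n.
Unshelve. all: by end_near. Qed.

Lemma is_cvg_geometric_bound u (K r : R) : 0 <= r < 1 ->
  (forall n, `|u n| <= (K * r ^+ n)%:C) ->
  cvgn (fun N => \sum_(0 <= n < N) u n : C^o).
Proof.
move=> /andP[r0 r1] uK.
have real_cvg (w : nat -> R) : (forall n, `|w n| <= K * r ^+ n) -> cvgn (series w).
  move=> wK; apply: normed_cvg.
  apply: (@series_le_cvg _ _ (geometric K r)) => [n|n|n|].
  - exact: normr_ge0.
  - exact: le_trans (normr_ge0 _) (wK n).
  - exact: wK.
  - by apply: is_cvg_geometric_series; rewrite ger0_norm.
have /real_cvg cRe n : `|complex.Re (u n)| <= K * r ^+ n.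
  by rewrite -lecR (le_trans (Re_le_norm _)).
have /real_cvg cIm n : `|complex.Im (u n)| <= K * r ^+ n.
  by rewrite -lecR (le_trans (Im_le_norm _)).
apply/cvg_ex; exists ((limn (series (fun n => complex.Re (u n))) +i*
                       limn (series (fun n => complex.Im (u n))))%C : C^o).
have ReS N : complex.Re (\sum_(0 <= n < N) u n) = series (fun n => complex.Re (u n)) N.
  rewrite /series /=; elim: N => [|N IH]; first by rewrite !big_nil.
  by rewrite !big_nat_recr //= -IH; case: (\sum_(0 <= i < N) _) => ??; case: (u N).
have ImS N : complex.Im (\sum_(0 <= n < N) u n) = series (fun n => complex.Im (u n)) N.
  rewrite /series /=; elim: N => [|N IH]; first by rewrite !big_nil.
  by rewrite !big_nat_recr //= -IH; case: (\sum_(0 <= i < N) _) => ??; case: (u N).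
apply: cvg_complex.
- by under eq_fun do rewrite ReS.
- by under eq_fun do rewrite ImS.
Qed.

Lemma norm_lim_le u (l c : R[i]) (B : R) :
  (u n : C^o) @[n --> \oo] --> (l : C^o) ->
  (\forall n \near \oo, `|u n - c| <= B%:C) -> `|l - c| <= B%:C.
Proof.
move=> ul uB; apply/ler_addgt0Pl => e e0.
move/cvgrPdist_le : ul => /(_ _ e0) ul.
near \oo => n.
rewrite (le_trans (ler_distD (u n) _ _)) // lerD //; near: n => //.
Unshelve. all: by end_near. Qed.

End ComplexSequences.

Section BilateralSums.
Variable R : realType.
Let C : numFieldType := R[i].
Implicit Types (f g : int -> R[i]).

(** Truncating both halves at the same N turns the two limits of [zsum] into one, so that identities
    between bilateral sums can be checked on partial sums. *)
Definition psum f (N : nat) : R[i] :=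
  \sum_(0 <= n < N) f (Posz n) + \sum_(0 <= n < N) f (Negz n).

Definition geo_decay f := exists K r : R,
  0 <= r < 1 /\ forall n : nat,
    `|f (Posz n)| <= (K * r ^+ n)%:C /\ `|f (Negz n)| <= (K * r ^+ n)%:C.

Lemma psum_cvg f : geo_decay f -> (psum f N : C^o) @[N --> \oo] --> (zsum f : C^o).
Proof.
move=> [K [r [r1 fK]]]; apply: cvgD.
  exact: is_cvg_geometric_bound r1 (fun n => (fK n).1).
exact: is_cvg_geometric_bound r1 (fun n => (fK n).2).
Qed.

Lemma zsum_unique f l : geo_decay f -> (psum f N : C^o) @[N --> \oo] --> (l : C^o) ->
  zsum f = l.
Proof.
move=> /psum_cvg fz fl.
exact: (@cvg_unique _ (@norm_hausdorff C C^o) _ _ _ _ fz fl).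
Qed.

Lemma eq_zsum f g : f =1 g -> zsum f = zsum g.
Proof. by move=> fg; congr zsum; apply/funext. Qed.

Lemma geo_decayZ (c : R[i]) f : geo_decay f -> geo_decay (fun n => c * f n).
Proof.
move=> [K [r [r1 fK]]]; exists (complex.Re `|c| * K), r; split=> // n.
have cE : `|c| = (complex.Re `|c|)%:C by rewrite normc_def.
have -> : (complex.Re `|c| * K * r ^+ n)%:C = `|c| * (K * r ^+ n)%:C.
  by rewrite -mulrA [LHS]real_complexM -cE.
have [fn fN] := fK n; split; rewrite [`|c * _|]normrM.
  exact: ler_wpM2l (normr_ge0 c) _ _ fn.
exact: ler_wpM2l (normr_ge0 c) _ _ fN.
Qed.

Lemma zsumZ (c : R[i]) f : geo_decay f -> zsum (fun n => c * f n) = c * zsum f.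
Proof.
move=> fd; apply: zsum_unique; first exact: geo_decayZ.
have -> : (fun N => psum (fun n => c * f n) N : C^o) = (fun N => (c : C^o) *: (psum f N : C^o)).
  by apply/funext => N; rewrite /psum -!mulr_sumr -mulrDr.
exact: cvgZr (psum_cvg fd).
Qed.

Lemma geo_decay_le f g : geo_decay g -> (forall n, `|f n| <= `|g n|) -> geo_decay f.
Proof.
move=> [K [r [r1 fK]]] fg; exists K, r; split=> // n.
by split; [exact: le_trans (fg _) (fK n).1|exact: le_trans (fg _) (fK n).2].
Qed.

Lemma geo_decayD f g : geo_decay f -> geo_decay g -> geo_decay (fun n => f n + g n).
Proof.
move=> [K [r [r1 fK]]] [K' [r' [r'1 gK]]].
exists (`|K| + `|K'|), (Num.max r r'); split=> [|n].
  by case: (leP r r').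
have mono (k s : R) (x : R[i]) : 0 <= s -> s <= Num.max r r' ->
    `|x| <= (k * s ^+ n)%:C -> `|x| <= (`|k| * Num.max r r' ^+ n)%:C.
  move=> s0 sm /le_trans; apply; rewrite lecR.
  apply: le_trans (ler_norm _) _; rewrite normrM ler_wpM2l //.
  by rewrite ger0_norm ?exprn_ge0 // lerXn2r // nnegrE // (le_trans s0).
have /andP[r0 _] := r1; have /andP[r'0 _] := r'1.
have rm : r <= Num.max r r' by rewrite le_max lexx.
have r'm : r' <= Num.max r r' by rewrite le_max lexx orbT.
split; rewrite mulrDl real_complexD (le_trans (ler_normD _ _)) // lerD //.
- exact: mono r0 rm (fK n).1.
- exact: mono r'0 r'm (gK n).1.
- exact: mono r0 rm (fK n).2.
- exact: mono r'0 r'm (gK n).2.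
Qed.

Lemma zsumD f g : geo_decay f -> geo_decay g ->
  zsum (fun n => f n + g n) = zsum f + zsum g.
Proof.
move=> fd gd; apply: zsum_unique; first exact: geo_decayD.
have -> : (fun N => psum (fun n => f n + g n) N : C^o) =
          (fun N => (psum f N : C^o) + (psum g N : C^o)).
  by apply/funext => N; rewrite /psum !big_split /= addrACA.
exact: cvgD (psum_cvg fd) (psum_cvg gd).
Qed.

Lemma geo_decay_cvg0 f : geo_decay f ->
  (f (Posz n) : C^o) @[n --> \oo] --> (0 : C^o) /\
  (f (Negz n) : C^o) @[n --> \oo] --> (0 : C^o).
Proof.
move=> [K [r [/andP[r0 r1] fK]]].
have gK : (geometric K r) @ \oo --> (0:R) by apply: cvg_geometric; rewrite ger0_norm.
split; apply/cvgrPdist_le => e /complex_pos[d d0 ->];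
  move/cvgrPdist_le : gK => /(_ _ d0) gK; near=> n; rewrite sub0r normrN.
  apply: (le_trans (fK n).1); rewrite lecR.
  have : `|0 - geometric K r n| <= d by near: n.
  by rewrite sub0r normrN; apply: le_trans; rewrite ler_norm.
apply: (le_trans (fK n).2); rewrite lecR.
have : `|0 - geometric K r n| <= d by near: n.
by rewrite sub0r normrN; apply: le_trans; rewrite ler_norm.
Unshelve. all: by end_near. Qed.

Lemma zsum_shift f : geo_decay f -> geo_decay (fun n => f (n + 1)) ->
  zsum (fun n => f (n + 1)) = zsum f.
Proof.
move=> fd f1d; apply: zsum_unique => //.
have [f0p f0n] := geo_decay_cvg0 fd.
(* The shifted window gains the term N and loses the term -N, and both tend to 0. *)
have -> : (fun N => psum (fun n => f (n + 1)) N : C^o) =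
          (fun N => (psum f N : C^o) + ((f (Posz N) : C^o) - f (- Posz N))).
  apply/funext; elim=> [|N IH]; first by rewrite /psum !big_nil oppr0 subrr !addr0.
  move: IH; rewrite /psum !big_nat_recr //= => IH.
  rewrite addrACA IH.
  have -> : Posz N + 1 = Posz N.+1 by lia.
  have -> : Negz N + 1 = - Posz N by lia.
  have -> : - Posz N.+1 = Negz N by lia.
  ring.
have f0n' : (f (- Posz N) : C^o) @[N --> \oo] --> (0 : C^o).
  apply/cvgrPdist_le => e e0; move/cvgrPdist_le : f0n => /(_ _ e0) [N _ hN].
  exists N.+1 => //; case=> [|n] /= Nn; first by [].
  by have := hN n Nn; rewrite /= NegzE.
rewrite -[zsum f]addr0 -[in X in _ --> X](subrr (0 : C^o)).
apply: cvgD; first exact: psum_cvg.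
exact: cvgB.
Qed.

(* The window of [psum] is [-N, N-1], so only the terms n = 0 and n = -1 are
   left out of the geometric bound. *)
Lemma zsum_bound f (K r : R) : 0 <= r <= 1 / 2 -> geo_decay f ->
  (forall n : nat, (0 < n)%N ->
    `|f (Posz n)| <= (K * r ^+ n)%:C /\ `|f (Negz n)| <= (K * r ^+ n)%:C) ->
  `|zsum f - (f 0 + f (-1))| <= (4 * K * r)%:C.
Proof.
move=> /andP[r0 r2] fd fK.
have K0 : 0 <= K * r.
  rewrite -lecR -[r]expr1; exact: le_trans (normr_ge0 _) (fK 1%N isT).1.
(* The bound is strengthened to 2 - 2 r^N, which is inductive exactly because r <= 1/2. *)
have geoS N : \sum_(0 <= n < N) r ^+ n <= 2.
  rewrite -[X in _ <= X]subr0; apply: (@le_trans _ _ (2 - 2 * r ^+ N)); last first.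
    by rewrite lerB // mulr_ge0 // exprn_ge0.
  elim: N => [|N IH]; first by rewrite big_nil expr0 mulr1 subrr.
  rewrite big_nat_recr //= exprS.
  have := exprn_ge0 N r0; nra.
apply: norm_lim_le (psum_cvg fd) _; near=> N.
have [M ->] : exists M, N = M.+1 by exists N.-1; rewrite prednK //; near: N; exists 1%N.
rewrite [-1](_ : _ = Negz 0) // /psum !big_nat_recl //=.
have cancel (a b c d : R[i]) : a + b + (c + d) - (a + c) = b + d by ring.
rewrite cancel.
rewrite (le_trans (ler_normD _ _)) //.
have half (h : nat -> R[i]) : (forall n, `|h n| <= (K * r ^+ n.+1)%:C) ->
    `|\sum_(0 <= n < M) h n| <= (2 * (K * r))%:C.
  move=> hK; apply: le_trans (ler_norm_sum _ _ _) _.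
  apply: (@le_trans _ _ (\sum_(0 <= n < M) (K * r ^+ n.+1)%:C)).
    by apply: ler_sum => n _.
  rewrite -rmorph_sum lecR.
  under eq_bigr do rewrite exprS mulrA.
  by rewrite -mulr_sumr mulrC ler_wpM2r.
have -> : (4 * K * r)%:C = (2 * (K * r))%:C + (2 * (K * r))%:C.
  by rewrite -real_complexD; congr _%:C; ring.
by rewrite lerD // half // => n; [exact: (fK n.+1 isT).1|exact: (fK n.+1 isT).2].
Unshelve. all: by end_near. Qed.

End BilateralSums.

(** * Products of bilateral series *)

Section Rotation.
Variable R : realType.
Let C : numFieldType := R[i].
Implicit Types (f g : int -> R[i]).

Definition window (N : nat) : seq int :=
  [seq Posz n | n <- iota 0 N] ++ [seq Negz n | n <- iota 0 N].

Lemma mem_window N (n : int) : (n \in window N) = (- Posz N <= n < Posz N).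
Proof.
rewrite mem_cat; case: n => n.
  rewrite mem_map ?mem_iota; last by move=> ? ? [].
  rewrite [X in _ || X](_ : _ = false); first by lia.
  by apply/negP => /mapP[].
rewrite [X in _ || X]mem_map ?mem_iota; last by move=> ? ? [].
rewrite [X in X || _](_ : _ = false); first by lia.
by apply/negP => /mapP[].
Qed.

Lemma window_uniq N : uniq (window N).
Proof.
rewrite cat_uniq !map_inj_uniq ?iota_uniq ?andbT /=; try by move=> ? ? [].
by apply/hasPn => x /mapP[n _ ->]; apply/negP => /mapP[].
Qed.

Lemma psum_window f N : psum f N = \sum_(n <- window N) f n.
Proof. by rewrite big_cat !big_map /psum /index_iota !subn0. Qed.

Definition box N : seq (int * int) := [seq (x, y) | x <- window N, y <- window N].

Lemma mem_box N x : (x \in box N) = (x.1 \in window N) && (x.2 \in window N).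
Proof.
case: x => x y; apply/allpairsP/andP => [[[a b] [/= xa yb [-> ->]]] //|[xw yw]].
by exists (x, y).
Qed.

Definition rot_even (x : int * int) := (x.1 + x.2, x.1 - x.2).
Definition rot_odd (x : int * int) := (x.1 + x.2 + 1, x.1 - x.2).
Definition rot_box N := map rot_even (box N) ++ map rot_odd (box N).

Lemma box_uniq N : uniq (box N).
Proof. by apply: allpairs_uniq; rewrite ?window_uniq //; move=> [a b] [c d] _ _ /= [-> ->]. Qed.

Lemma rot_box_uniq N : uniq (rot_box N).
Proof.
rewrite cat_uniq !map_inj_uniq ?box_uniq ?andbT /=.
- apply/hasPn => x /mapP[[p r] _ ->]; apply/negP => /mapP[[p' r'] _].
  by rewrite /rot_even /rot_odd => -[] /=; lia.
- by move=> [p r] [p' r']; rewrite /rot_odd => -[] /= h1 h2; congr (_, _); lia.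
- by move=> [p r] [p' r']; rewrite /rot_even => -[] /= h1 h2; congr (_, _); lia.
Qed.

(** The parity of n + m selects the rotation. The preimage is a rounded half-sum and
    half-difference; the window [-N, N-1] is closed under both, its extra negative point absorbing
    the -1 of the odd case. *)
Lemma box_sub_rot N : {subset box N <= rot_box N}.
Proof.
move=> [n m]; rewrite mem_box !mem_window /= => nm; rewrite mem_cat; apply/orP.
have [e|o] : (exists k, n + m = 2 * k) \/ (exists k, n + m = 2 * k + 1).
  by have := divz_eq (n + m) 2; have := modz_ge0 (n + m) (isT : 2 != 0 :> int);
    have := ltz_mod (n + m) (isT : 2 != 0 :> int); 
    case: (boolP ((n + m) %% 2 == 0)%Z) => h ? ? ?; [left|right]; exists ((n + m) %/ 2)%Z; lia.
  left; case: e => k e; apply/mapP; exists (k, n - k).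
    by rewrite mem_box !mem_window /=; lia.
  by rewrite /rot_even; congr (_, _) => /=; lia.
right; case: o => k e; apply/mapP; exists (k, n - k - 1).
  by rewrite mem_box !mem_window /=; lia.
by rewrite /rot_odd; congr (_, _) => /=; lia.
Qed.

Lemma rot_sub_box N : {subset rot_box N <= box (2 * N)}.
Proof.
move=> x; rewrite mem_cat => /orP[] /mapP[[p r]]; rewrite !mem_box !mem_window /= => h ->;
  rewrite /rot_even /rot_odd /=; lia.
Qed.

Lemma big_subset (I : eqType) (V : nmodType) (s t : seq I) (F : I -> V) :
  uniq s -> uniq t -> {subset s <= t} ->
  \sum_(x <- t) F x = \sum_(x <- s) F x + \sum_(x <- t | x \notin s) F x.
Proof.
move=> us ut st; rewrite (bigID (mem s)) /=; congr (_ + _).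
rewrite -big_filter; apply: perm_big; apply: uniq_perm; rewrite ?filter_uniq //.
by move=> x; rewrite mem_filter; case xs : (x \in s) => //=; apply: st.
Qed.

(** The terms of t outside s are among the terms of w outside s. The right side involves s and w
    only, so the shape of t does not matter. *)
Lemma norm_sum_subset (I : eqType) (s t w : seq I) (F : I -> R[i]) :
  uniq s -> uniq t -> uniq w -> {subset s <= t} -> {subset t <= w} ->
  `|\sum_(x <- t) F x - \sum_(x <- s) F x| <=
  \sum_(x <- w) `|F x| - \sum_(x <- s) `|F x|.
Proof.
move=> us ut uw st tw.
rewrite (big_subset F us ut st) addrC addKr.
rewrite (big_subset (fun x => `|F x|) us uw (fun x xs => tw _ (st _ xs))) [X in _ <= X]addrC addKr.
apply: le_trans (ler_norm_sum _ _ _) _.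
rewrite -big_filter -[X in _ <= X]big_filter.
rewrite [X in _ <= X](@big_subset _ _ [seq x <- t | x \notin s]) ?filter_uniq //.
  by rewrite lerDl sumr_ge0.
by move=> x; rewrite !mem_filter => /andP[-> /tw].
Qed.

Lemma psum_box f g N : psum f N * psum g N = \sum_(x <- box N) f x.1 * g x.2.
Proof.
rewrite !psum_window big_distrl /= big_allpairs; apply: eq_bigr => n _.
by rewrite big_distrr.
Qed.

Lemma cvgn_double (u : nat -> R[i]) (l : R[i]) :
  (u n : C^o) @[n --> \oo] --> (l : C^o) ->
  (u (2 * n)%N : C^o) @[n --> \oo] --> (l : C^o).
Proof.
move=> ul; apply/cvgrPdist_le => e e0; move/cvgrPdist_le : ul => /(_ _ e0) [N _ hN].
by exists N => // n /= Nn; apply: hN => /=; lia.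
Qed.

(* Summing over Z^2 along the lattices n + m even and n + m odd: the rotated
   square lies between the squares of size N and 2N, so absolute convergence
   makes both partial sums converge to the same limit. *)
Lemma zsum_mul_rotate f g h1 h2 k1 k2 :
  geo_decay f -> geo_decay g -> geo_decay h1 -> geo_decay h2 ->
  geo_decay k1 -> geo_decay k2 ->
  (forall p r, f (p + r) * g (p - r) = h1 p * h2 r) ->
  (forall p r, f (p + r + 1) * g (p - r) = k1 p * k2 r) ->
  zsum f * zsum g = zsum h1 * zsum h2 + zsum k1 * zsum k2.
Proof.
move=> fd gd h1d h2d k1d k2d hE kE.
pose F x := f x.1 * g x.2.
have rotE N : \sum_(x <- rot_box N) F x = psum h1 N * psum h2 N + psum k1 N * psum k2 N.
  rewrite big_cat !big_map !psum_box; congr (_ + _); apply: eq_bigr => x _.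
    exact: hE.
  exact: kE.
have rotL : ((\sum_(x <- rot_box N) F x : R[i]) : C^o) @[N --> \oo] -->
    (zsum h1 * zsum h2 + zsum k1 * zsum k2 : C^o).
  under eq_fun do rewrite rotE.
  by apply: cvgD; apply: cvgM; exact: psum_cvg.
have boxL : ((\sum_(x <- box N) F x : R[i]) : C^o) @[N --> \oo] --> (zsum f * zsum g : C^o).
  have -> : (fun N => (\sum_(x <- box N) F x : R[i]) : C^o) =
            (fun N => (psum f N : C^o) * (psum g N : C^o)).
    by apply/funext => N; rewrite [RHS]psum_box.
  by apply: cvgM; exact: psum_cvg.
have nfd : geo_decay (fun n => `|f n|) by apply: geo_decay_le fd _ => n; rewrite normr_id.
have ngd : geo_decay (fun n => `|g n|) by apply: geo_decay_le gd _ => n; rewrite normr_id.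
pose A N : R[i] := \sum_(x <- box N) `|F x|.
have AL : (A N : C^o) @[N --> \oo] --> (zsum (fun n => `|f n|) * zsum (fun n => `|g n|) : C^o).
  have -> : (fun N => A N : C^o) =
            (fun N => (psum (fun n => `|f n|) N : C^o) * (psum (fun n => `|g n|) N : C^o)).
    apply/funext => N; rewrite [RHS]psum_box; apply: eq_bigr => x _.
    exact: normrM.
  by apply: cvgM; exact: psum_cvg.
have AL0 : (A (2 * N)%N - A N : C^o) @[N --> \oo] --> (0 : C^o).
  rewrite -[X in _ --> X](subrr (zsum (fun n => `|f n|) * zsum (fun n => `|g n|) : C^o)).
  by apply: cvgB; [exact: (cvgn_double AL)|exact: AL].
have dL : ((\sum_(x <- rot_box N) F x - \sum_(x <- box N) F x : R[i]) : C^o)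
    @[N --> \oo] --> (0 : C^o).
  apply/cvgrPdist_le => e e0; move/cvgrPdist_le : AL0 => /(_ _ e0) hA.
  near=> N; rewrite sub0r normrN.
  apply: le_trans (norm_sum_subset F (box_uniq N) (rot_box_uniq N) (box_uniq (2 * N))
    (@box_sub_rot N) (@rot_sub_box N)) _.
  have : `|0 - (A (2 * N)%N - A N)| <= e by near: N.
  rewrite sub0r normrN; apply: le_trans.
  (* An element of [R[i]] is comparable with its norm only if it is real; sums of norms are. *)
  apply: real_ler_norm.
  by rewrite rpredB // ger0_real // sumr_ge0.
apply/eqP; rewrite eq_sym -subr_eq0; apply/eqP.
exact: (@cvg_unique _ (@norm_hausdorff C C^o) _ _ _ _ (cvgB rotL boxL) dL).
Unshelve. all: by end_near. Qed.

End Rotation.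

(** * The complex exponential *)

Section ComplexExponential.
Variable R : realType.
Implicit Types (w x y z : R[i]).

Lemma ReD x y : complex.Re (x + y) = complex.Re x + complex.Re y.
Proof. by case: x y => ? ? []. Qed.

Lemma ImD x y : complex.Im (x + y) = complex.Im x + complex.Im y.
Proof. by case: x y => ? ? []. Qed.

Lemma ReN x : complex.Re (- x) = - complex.Re x.
Proof. by case: x. Qed.

Lemma ImN x : complex.Im (- x) = - complex.Im x.
Proof. by case: x. Qed.

Lemma CexpD x y : Cexp (x + y) = Cexp x * Cexp y.
Proof.
rewrite /Cexp ReD ImD expRD cosD sinD.
move: (expR _) (expR _) (cos _) (sin _) (cos _) (sin _) => a b c s c' s'.
apply/eqP; rewrite eq_complex /=; apply/andP; split; apply/eqP; ring.
Qed.

Lemma Cexp0 : Cexp (0 : R[i]) = 1.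
Proof. by rewrite /Cexp /= expR0 cos0 sin0 mul1r. Qed.

Lemma Cexp_norm z : `|Cexp z| = (expR (complex.Re z))%:C.
Proof.
rewrite normrM [`|(expR _)%:C|]ger0_norm ?ler0c ?expR_ge0 //.
by rewrite [`|_ +i* _|]normc_def /= cos2Dsin2 sqrtr1 mulr1.
Qed.

Lemma Cexp_neq0 z : Cexp z != 0.
Proof. by rewrite -normr_eq0 Cexp_norm (inj_eq (@complexI R)) gt_eqF // expR_gt0. Qed.

Definition ee x : R[i] := Cexp (Cpi R * 'i * x).

Lemma eeD x y : ee (x + y) = ee x * ee y.
Proof. by rewrite /ee mulrDr CexpD. Qed.

Lemma ee0 : ee 0 = 1.
Proof. by rewrite /ee mulr0 Cexp0. Qed.

Lemma ee_neq0 x : ee x != 0.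
Proof. exact: Cexp_neq0. Qed.

Lemma eeN x : ee (- x) = (ee x)^-1.
Proof.
by apply: (mulfI (ee_neq0 x)); rewrite -eeD subrr ee0 mulfV // ee_neq0.
Qed.

Lemma CpiM_i x : Cpi R * 'i * x = (- (pi * complex.Im x) +i* (pi * complex.Re x))%C.
Proof.
rewrite /Cpi; case: x => a b; apply/eqP; rewrite eq_complex /=.
apply/andP; split; apply/eqP; ring.
Qed.

Lemma ee_norm x : `|ee x| = (expR (- (pi * complex.Im x)))%:C.
Proof. by rewrite Cexp_norm CpiM_i. Qed.

Lemma ee1 : ee 1 = -1.
Proof.
rewrite /ee CpiM_i /Cexp /= mulr0 mulr1 oppr0 expR0 cospi sinpi mul1r.
by apply/eqP; rewrite eq_complex /= oppr0 !eqxx.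
Qed.

Lemma ee2 : ee 2 = 1.
Proof. by rewrite -[2]/(1 + 1) eeD ee1 mulrNN mulr1. Qed.

Lemma ee_half : ee (1 / 2) = 'i.
Proof.
have h : (1 / 2 : R[i]) = (2^-1 : R)%:C by rewrite div1r [RHS]fmorphV rmorph_nat.
rewrite /ee CpiM_i h /Cexp /= mulr0 oppr0 expR0 cos_pihalf sin_pihalf mul1r.
by rewrite complexiE.
Qed.

Lemma ee_even (n : int) : ee (2 * n%:~R) = 1.
Proof.
have nat_case (m : nat) : ee (2 * m%:R) = 1.
  elim: m => [|m IH]; first by rewrite mulr0 ee0.
  by rewrite -[m.+1%:R]natr1 mulrDr eeD IH mulr1 ee2 mulr1.
case: n => n; first exact: nat_case.
by rewrite NegzE mulrNz mulrN eeN nat_case invr1.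
Qed.

Lemma ee_odd (n : int) : ee (2 * n%:~R + 1) = -1.
Proof. by rewrite eeD ee_even ee1 mul1r. Qed.

(** Everything follows from [1 + y <= expR y] at x and at -x. The latter gives e^x - 1 <= x e^x,
    hence 0 <= e^x - 1 - x <= x (e^x - 1). *)
Lemma expR_sub1 (x : R) : `|expR x - 1| <= `|x| * expR `|x| /\
  `|expR x - 1 - x| <= `|x| ^+ 2 * expR `|x|.
Proof.
have lo (y : R) : 1 + y <= expR y := expR_ge1Dx y.
have hi : expR x - 1 <= x * expR x.
  have := lo (- x); rewrite expRN => h; have := expR_gt0 x => e0.
  have : (1 - x) * expR x <= (expR x)^-1 * expR x by rewrite ler_pM2r.
  rewrite mulVf ?gt_eqF //; lra.
have lox := lo x.
have E0 := expR_gt0 x; have e1 : 1 <= expR `|x| by rewrite -[1](@expR0 R) ler_expR.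
have le_e : expR x <= expR `|x| by rewrite ler_expR ler_norm.
set E := expR x in hi lox E0 le_e *; set F := expR `|x| in e1 le_e *.
have a0 : 0 <= `|x| := normr_ge0 x.
have F0 : 0 <= F - 1 by lra.
have M1 : `|E - 1| <= `|x| * F.
  rewrite ler_norml; case: (ger0P x) a0 => x0 a0.
    have xF : x * E <= x * F by rewrite ler_wpM2l.
    by apply/andP; split; nra.
  apply/andP; split; nra.
split=> //.
have : `|x * (E - 1)| <= `|x| ^+ 2 * F by rewrite normrM expr2 -mulrA ler_wpM2l.
have nn : 0 <= E - 1 - x by lra.
rewrite (ger0_norm nn) => h; apply: le_trans h; apply: le_trans (ler_norm _).
by rewrite mulrBr mulr1; lra.
Qed.

Lemma mvt0 (f df : R -> R) (y : R) : (forall t : R, is_derive t 1 f (df t)) ->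
  exists2 c, `|c| <= `|y| & f y - f 0 = df c * y.
Proof.
move=> fdf.
have cont (a b : R) : {within `[a, b], continuous f}.
  by apply: derivable_within_continuous => x _; case: (fdf x).
have [y0|y0] := leP 0 y.
  have [c cy e] := MVT_segment y0 (fun (t : R) _ => fdf t) (cont 0 y).
  exists c; last by rewrite e subr0.
  by move: cy; rewrite in_itv /= => /andP[c0 cy]; rewrite !ger0_norm // (le_trans c0).
have [c cy e] := MVT_segment (ltW y0) (fun (t : R) _ => fdf t) (cont y 0).
exists c.
  move: cy; rewrite in_itv /= => /andP[yc c0].
  by rewrite !ler0_norm ?lerN2 // ltW.
by rewrite -[LHS]opprB e sub0r mulrN opprK.
Qed.

Lemma cos_sub1 (y : R) : `|cos y - 1| <= `|y| /\ `|cos y - 1| <= `|y| ^+ 2.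
Proof.
have sin_le (x : R) : `|sin x| <= `|x|.
  have [c _] := mvt0 x (@is_derive_sin R); rewrite sin0 subr0 => ->.
  rewrite normrM ler_piMl //; exact: cos_max.
have [c cy] := mvt0 y (@is_derive_cos R); rewrite cos0 => ->.
rewrite normrM normrN; split.
  by rewrite ler_piMl // sin_max.
by rewrite expr2 ler_wpM2r // (le_trans (sin_le _)).
Qed.

Lemma sin_subid (y : R) : `|sin y - y| <= `|y| ^+ 2.
Proof.
have [c cy] := mvt0 y (@is_derive_sin R); rewrite sin0 subr0 => ->.
rewrite -[X in _ - X]mul1r -mulrBl normrM expr2 ler_wpM2r //.
by apply: le_trans cy; exact: (cos_sub1 c).1.
Qed.

(** The real part of the remainder splits into three errors and the imaginary part into two, each at
    most m^2 e^m; hence the 5. *)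
Lemma Cexp_sub1 w (m : R) : `|w| <= m%:C ->
  `|Cexp w - 1 - w| <= (5 * m ^+ 2 * expR m)%:C.
Proof.
move=> wm.
have xm : `|complex.Re w| <= m by rewrite -lecR (le_trans (Re_le_norm _)).
have ym : `|complex.Im w| <= m by rewrite -lecR (le_trans (Im_le_norm _)).
apply: le_trans (norm_le_ReIm _) _; rewrite lecR.
rewrite !(ReD, ReN, ImD, ImN) /Cexp.
move: xm ym; case: w {wm} => x y /=; rewrite !mul0r subr0 addr0 oppr0 addr0 => xm ym.
have m0 : 0 <= m := le_trans (normr_ge0 _) xm.
have e1 : 1 <= expR m by rewrite -[1](@expR0 R) ler_expR.
have [E1 E2] := expR_sub1 x.
have [C1 C2] := cos_sub1 y; have S2 := sin_subid y.
have xem : expR `|x| <= expR m by rewrite ler_expR.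
have m2 (a b : R) : `|a| <= m -> `|b| <= m -> `|a| * `|b| <= m ^+ 2.
  by move=> am bm; rewrite expr2 ler_pM.
have bE2 : `|expR x - 1 - x| <= m ^+ 2 * expR m.
  by apply: le_trans E2 _; rewrite ler_pM ?expR_ge0 ?sqr_ge0 // expr2 m2.
have bE1 : `|expR x - 1| <= m * expR m.
  by apply: le_trans E1 _; rewrite ler_pM ?expR_ge0.
have y2m : `|y| ^+ 2 <= m ^+ 2 by rewrite expr2 m2.
have mm : m ^+ 2 <= m ^+ 2 * expR m by rewrite ler_peMr // sqr_ge0.
have t1 : `|(expR x - 1 - x) * cos y| <= m ^+ 2 * expR m.
  by rewrite normrM (le_trans _ bE2) // ler_piMr // cos_max.
have t2 : `|x * (cos y - 1)| <= m ^+ 2 * expR m.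
  by rewrite normrM (le_trans _ mm) // expr2 ler_pM // (le_trans C1).
have t3 : `|cos y - 1| <= m ^+ 2 * expR m by rewrite (le_trans C2) // (le_trans y2m).
have siny : `|sin y| <= m.
  have [c _] := mvt0 y (@is_derive_sin R); rewrite sin0 subr0 => ->.
  by rewrite normrM (le_trans _ ym) // ler_piMl // cos_max.
have t4 : `|(expR x - 1) * sin y| <= m ^+ 2 * expR m.
  by rewrite normrM expr2 mulrAC ler_pM.
have t5 : `|sin y - y| <= m ^+ 2 * expR m by rewrite (le_trans S2) // (le_trans y2m).
have -> : expR x * cos y - 1 - x =
   (expR x - 1 - x) * cos y + x * (cos y - 1) + (cos y - 1) by ring.
have -> : expR x * sin y - y = (expR x - 1) * sin y + (sin y - y) by ring.
have := ler_normD ((expR x - 1 - x) * cos y + x * (cos y - 1)) (cos y - 1).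
have := ler_normD ((expR x - 1 - x) * cos y) (x * (cos y - 1)).
have := ler_normD ((expR x - 1) * sin y) (sin y - y).
rewrite -mulrA; lra.
Qed.

End ComplexExponential.

(** * Theta series with characteristic *)

Section ThetaSeries.
Variable R : realType.
Let C : numFieldType := R[i].
Implicit Types (a x y z tau : R[i]).

(** The free linear term absorbs factors growing like exp(M |n|) without changing [al]. Such factors
    appear in Taylor expansions in z, and [geo_decay] is not stable under them. *)
Definition gauss_bound (f : int -> R[i]) (al : R) := exists D B : R,
  forall n : int, `|f n| <= (expR (D + B * (absz n)%:R - al * (absz n)%:R ^+ 2))%:C.

Lemma gauss_decay f al : 0 < al -> gauss_bound f al -> geo_decay f.
Proof.
move=> al0 [D [B fB]].
(* The maximum over N of D + (B + al) N - al N^2, found by completing the square. *)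
pose M := D + (B + al) ^+ 2 / (4 * al).
have key (N : R) : D + B * N - al * N ^+ 2 <= M - al * N.
  rewrite /M -subr_ge0.
  have -> : D + (B + al) ^+ 2 / (4 * al) - al * N - (D + B * N - al * N ^+ 2)
      = al * (N - (B + al) / (2 * al)) ^+ 2.
    by field; rewrite gt_eqF.
  by rewrite mulr_ge0 ?sqr_ge0 ?ltW.
exists (expR M), (expR (- al)); split.
  by rewrite expR_ge0 /= -[1](@expR0 R) ltr_expR oppr_lt0.
have powE (n : nat) : expR M * expR (- al) ^+ n = expR (M - al * n%:R).
  by rewrite -expRM_natl -expRD; congr expR; ring.
move=> n; rewrite powE; split; apply: le_trans (fB _) _; rewrite lecR ler_expR.
  exact: key.
apply: le_trans (key _) _; rewrite lerD2l lerN2; apply: ler_wpM2l (ltW al0) _ _ _.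
by rewrite ler_nat; lia.
Qed.

Definition theta_term a z tau (n : int) : R[i] :=
  ee ((n%:~R + a) ^+ 2 * tau + 2 * (n%:~R + a) * z).

(** The characteristic b is absorbed into z, and a is an arbitrary complex number, so that
    translating z by [c * tau] just adds c to a. *)
Definition thetac a z tau : R[i] := zsum (theta_term a z tau).

Lemma theta_thetac (a b : nat) z tau :
  theta a b z tau = thetac (a%:R / 2) (z + b%:R / 2) tau.
Proof. by apply: eq_zsum => n; rewrite /theta_term /ee; congr Cexp; ring. Qed.

Lemma ImMr (r : R) x : complex.Im (r%:C * x) = r * complex.Im x.
Proof. by case: x => p q /=; rewrite mul0r addr0. Qed.

Lemma absz_sqr (n : int) : (absz n)%:R ^+ 2 = n%:~R ^+ 2 :> R.
Proof. by case: n => n //; rewrite NegzE mulrNz sqrrN. Qed.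

Lemma theta_term_gauss a z tau :
  gauss_bound (theta_term a z tau) (pi * complex.Im tau).
Proof.
set w := 2 * a * tau + 2 * z; pose b := complex.Im w.
exists (- (pi * complex.Im (a ^+ 2 * tau + 2 * a * z))), (pi * `|b|) => n.
rewrite ee_norm lecR ler_expR.
have intC : n%:~R = (n%:~R : R)%:C :> R[i] by rewrite rmorph_int.
have -> : (n%:~R + a) ^+ 2 * tau + 2 * (n%:~R + a) * z =
   (n%:~R ^+ 2 : R)%:C * tau + (n%:~R : R)%:C * w
   + (a ^+ 2 * tau + 2 * a * z).
  have -> : (n%:~R ^+ 2 : R)%:C = (n%:~R : R)%:C ^+ 2 by exact: rmorphXn.
  by rewrite intC /w; ring.
move: (a ^+ 2 * tau + 2 * a * z) => w'.
rewrite !ImD !ImMr absz_sqr -/b; move: (complex.Im w') => c.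
have nb : - (n%:~R * b) <= `|b| * (absz n)%:R.
  apply: le_trans (ler_norm _) _; rewrite normrN normrM mulrC ler_wpM2l //.
  by rewrite -intr_norm -abszE.
have := ler_wpM2l (ltW (pi_gt0 R)) nb.
rewrite !mulrDr; lra.
Qed.

Lemma theta_term_decay a z tau : 0 < complex.Im tau -> geo_decay (theta_term a z tau).
Proof.
move=> t0; apply: gauss_decay (theta_term_gauss _ _ _).
by rewrite mulr_gt0 // pi_gt0.
Qed.

Section FunctionalEquations.
Variable tau : R[i].
Hypothesis tau0 : 0 < complex.Im tau.

Lemma thetac_succ a z : thetac (a + 1) z tau = thetac a z tau.
Proof.
have shiftE : theta_term (a + 1) z tau =1 (fun n => theta_term a z tau (n + 1)).
  by move=> n; rewrite /theta_term intrD; congr ee; ring.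
rewrite /thetac (eq_zsum shiftE) zsum_shift //; first exact: theta_term_decay.
by rewrite -(funext shiftE); exact: theta_term_decay.
Qed.

Lemma thetac_add1 a z : thetac a (z + 1) tau = ee (2 * a) * thetac a z tau.
Proof.
rewrite /thetac -zsumZ; last exact: theta_term_decay.
apply: eq_zsum => n; rewrite /theta_term -eeD.
rewrite -[RHS]mul1r -[X in _ = X * _](ee_even R n) -eeD; congr ee; ring.
Qed.

Lemma thetac_add_tau c a z :
  thetac a (z + c * tau) tau = ee (- c ^+ 2 * tau - 2 * c * z) * thetac (a + c) z tau.
Proof.
rewrite /thetac -zsumZ; last exact: theta_term_decay.
apply: eq_zsum => n; rewrite /theta_term -eeD; congr ee; ring.
Qed.

(** With n = p + r and m = p - r, (n + a)^2 + (m + a)^2 = 2 (p + a)^2 + 2 r^2. In the odd case n = p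
    + r + 1, so p and r are both replaced by themselves plus 1/2. The factor 2 becomes the doubling
    of tau. *)
Lemma thetac_mul a x y :
  thetac a x tau * thetac a y tau =
  thetac a (x + y) (2 * tau) * thetac 0 (x - y) (2 * tau)
  + thetac (a + 1 / 2) (x + y) (2 * tau) * thetac (1 / 2) (x - y) (2 * tau).
Proof.
have tau20 : 0 < complex.Im (2 * tau).
  by rewrite (_ : 2 * tau = tau + tau) ?ImD ?addr_gt0 //; ring.
have h2 : 2 * (1 / 2) = 1 :> R[i] by rewrite div1r mulfV // pnatr_eq0.
apply: zsum_mul_rotate; try exact: theta_term_decay.
  move=> p r; rewrite /theta_term -!eeD !(intrD, intrB); congr ee; ring.
by move=> p r; rewrite /theta_term -!eeD !(intrD, intrB); congr ee; field.
Qed.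

(** This is theta_11(0) = 0. The terms n and -1-n, that is [Posz n] and [Negz n], cancel, so every
    partial sum is already 0. *)
Lemma thetac_half_half : thetac (1 / 2) (1 / 2) tau = 0.
Proof.
apply: zsum_unique; first exact: theta_term_decay.
have -> : psum (theta_term (1 / 2) (1 / 2) tau) = fun=> 0.
  apply/funext => N; rewrite /psum -big_split big1 // => n _ /=.
  apply/eqP; rewrite addr_eq0; apply/eqP.
  rewrite -mulN1r -[X in _ = X * _](ee_odd R n) /theta_term -eeD NegzE; congr ee.
  rewrite mulrNz -[n.+1%:~R]/(n.+1%:R) -[n.+1%:R]natr1 -[n%:~R]/(n%:R); field.
  by [].
exact: (@cvg_cst C^o).
Qed.

End FunctionalEquations.

(** B depends on the majorant only, so a termwise error of order |h|^2 remains of that order after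
    summation. *)
Lemma norm_zsum_le g : geo_decay g -> exists2 B : R, 0 <= B &
  forall (c : R) f, 0 <= c -> (forall n, `|f n| <= c%:C * `|g n|) ->
    `|zsum f| <= (c * B)%:C.
Proof.
move=> gd; have [K [r [/andP[r0 r1] gK]]] := gd.
have K0 : 0 <= K.
  by rewrite -lecR -[K]mulr1 -(expr0 r); exact: le_trans (normr_ge0 _) (gK 0%N).1.
have r1' : 0 < 1 - r by lra.
exists (2 * K / (1 - r)); first by rewrite divr_ge0 ?mulr_ge0 // ltW.
move=> c f c0 fg.
have fd : geo_decay f.
  apply: geo_decay_le (geo_decayZ c%:C gd) _ => n.
  by rewrite normrM [`|c%:C|]ger0_norm ?ler0c.
rewrite -[zsum f]subr0; apply: norm_lim_le (psum_cvg fd) _; near=> N.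
rewrite subr0 /psum (le_trans (ler_normD _ _)) //.
have half (h : nat -> R[i]) : (forall n, `|h n| <= (c * (K * r ^+ n))%:C) ->
    `|\sum_(0 <= n < N) h n| <= (c * K / (1 - r))%:C.
  move=> hK; apply: le_trans (ler_norm_sum _ _ _) _.
  apply: (@le_trans _ _ (\sum_(0 <= n < N) (c * (K * r ^+ n))%:C)).
    by apply: ler_sum => n _.
  rewrite -rmorph_sum lecR.
  under eq_bigr do rewrite mulrA.
  rewrite -mulr_sumr; apply: ler_wpM2l; first exact: mulr_ge0.
  rewrite -[_^-1]div1r ler_pdivlMr //.
  have -> : (\sum_(0 <= n < N) r ^+ n) * (1 - r) = 1 - r ^+ N.
    elim: (N) => [|M IH]; first by rewrite big_nil mul0r expr0 subrr.
    by rewrite big_nat_recr //= mulrDl IH exprS; ring.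
  by rewrite gerBl exprn_ge0.
have -> : (c * (2 * K / (1 - r)))%:C = (c * K / (1 - r))%:C + (c * K / (1 - r))%:C.
  by rewrite -real_complexD; congr _%:C; ring.
have bnd (n : int) (k : nat) : `|g n| <= (K * r ^+ k)%:C -> `|f n| <= (c * (K * r ^+ k))%:C.
  move=> gn; apply: le_trans (fg n) _; rewrite real_complexM.
  by apply: (ler_wpM2l _ gn); rewrite ler0c.
by rewrite lerD // half // => n; [exact: bnd (gK n).1|exact: bnd (gK n).2].
Unshelve. all: by end_near. Qed.

Lemma Cexp_norm_le w (m : R) : `|w| <= m%:C -> `|Cexp w| <= (expR m)%:C.
Proof.
move=> wm; rewrite Cexp_norm lecR ler_expR (le_trans (ler_norm _)) //.
by rewrite -lecR (le_trans (Re_le_norm _)).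
Qed.

(** * Termwise expansion to second order of a series of exponentials *)

Section TermwiseDerivative.
Variables (c lam : int -> R[i]) (al L : R).
Hypotheses (al0 : 0 < al) (L0 : 0 <= L) (cG : gauss_bound c al).
Hypothesis lamL : forall n, `|lam n| <= (L * ((absz n)%:R + 1))%:C.

Let gauss_weaken (f : int -> R[i]) (A M : R) :
  (forall n, `|f n| <= `|c n| * (expR (A + M * (absz n)%:R))%:C) -> gauss_bound f al.
Proof.
have [D [B cB]] := cG => fc; exists (D + A), (B + M) => n.
apply: le_trans (fc n) _.
have -> : D + A + (B + M) * (absz n)%:R - al * (absz n)%:R ^+ 2 =
  (D + B * (absz n)%:R - al * (absz n)%:R ^+ 2) + (A + M * (absz n)%:R) by ring.
rewrite [X in _ <= X%:C]expRD [X in _ <= X]real_complexM; apply: (ler_wpM2r _ (cB n)).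
by rewrite ler0c expR_ge0.
Qed.

Lemma zsum_exp_decay (h : R[i]) : geo_decay (fun n => c n * Cexp (lam n * h)).
Proof.
pose m := complex.Re `|h|; have hm : `|h| = m%:C by rewrite /m normc_def.
have m0 : 0 <= m by rewrite -ler0c -hm.
apply: gauss_decay al0 _; apply: (gauss_weaken (A := L * m) (M := L * m)) => n.
rewrite normrM; apply: ler_wpM2l => //; apply: Cexp_norm_le.
rewrite normrM hm (_ : L * m + _ = L * ((absz n)%:R + 1) * m); last by ring.
by rewrite real_complexM; apply: (ler_wpM2r _ (lamL n)); rewrite ler0c.
Qed.

Lemma zsum_lam_decay : geo_decay (fun n => c n * lam n).
Proof.
apply: gauss_decay al0 _; apply: (gauss_weaken (A := L) (M := L)) => n.
rewrite normrM; apply: ler_wpM2l => //; apply: le_trans (lamL n) _; rewrite lecR.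
have -> : L + L * (absz n)%:R = L * ((absz n)%:R + 1) by ring.
by apply: le_trans (expR_ge1Dx _); rewrite lerDr.
Qed.

(** An explicit quadratic remainder serves twice: it yields the derivative at 0, and it lets
    first-order terms of products of theta functions be compared. *)
Lemma zsum_exp_taylor : exists2 B : R, 0 <= B &
  forall h : R[i], `|h| <= 1 ->
  `|zsum (fun n => c n * Cexp (lam n * h)) - zsum (fun n => c n * Cexp (lam n * 0))
    - h * zsum (fun n => c n * lam n)| <= `|h| ^+ 2 * B%:C.
Proof.
pose m n := L * ((absz n)%:R + 1).
have m0 n : 0 <= m n by rewrite mulr_ge0 // addr_ge0.
pose g (n : int) : R[i] := c n * (5 * m n ^+ 2 * expR (m n))%:C.
have gd : geo_decay g.
  (* Since m <= e^m, the factor 5 m^2 e^m is at most e^(k + 3m), which is linear in |n| in the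
     exponent. *)
  have [k e5] : exists k : R, 5 <= expR k by exists 5; have := expR_ge1Dx (5 : R); lra.
  apply: gauss_decay al0 _; apply: (gauss_weaken (A := k + 3 * L) (M := 3 * L)) => n.
  rewrite normrM; apply: ler_wpM2l => //.
  rewrite ger0_norm ?ler0c ?mulr_ge0 ?sqr_ge0 ?expR_ge0 // lecR.
  have -> : k + 3 * L + 3 * L * (absz n)%:R = k + m n + m n + m n by rewrite /m; ring.
  rewrite !expRD ler_pM ?mulr_ge0 ?sqr_ge0 ?expR_ge0 // -mulrA.

  have em : m n <= expR (m n) by have := expR_ge1Dx (m n); lra.
  by rewrite ler_pM ?sqr_ge0 // expr2 ler_pM.
have [B B0 gB] := norm_zsum_le gd; exists B => // h h1.
pose k := complex.Re `|h|; have hk : `|h| = k%:C by rewrite /k normc_def.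
have k0 : 0 <= k by rewrite -ler0c -hk.
have k1 : k <= 1 by rewrite -lecR -hk.
have -> : zsum (fun n => c n * Cexp (lam n * h)) - zsum (fun n => c n * Cexp (lam n * 0))
    - h * zsum (fun n => c n * lam n) =
    zsum (fun n => c n * Cexp (lam n * h) + (-1) * (c n * Cexp (lam n * 0))
                   + (- h) * (c n * lam n)).
  have d1 := zsum_exp_decay h; have d2 := zsum_exp_decay 0.
  rewrite !zsumD ?zsumZ ?mulN1r ?mulNr //; do ?apply: geo_decayD => //;
    do ?apply: geo_decayZ => //; exact: zsum_lam_decay.
have -> : `|h| ^+ 2 * B%:C = (k ^+ 2 * B)%:C.
  by rewrite hk real_complexM; congr (_ * _); rewrite !expr2 real_complexM.
apply: gB => [|n]; first exact: sqr_ge0.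
rewrite mulr0 Cexp0.
have -> : c n * Cexp (lam n * h) + (-1) * (c n * 1) + (- h) * (c n * lam n) =
   c n * (Cexp (lam n * h) - 1 - lam n * h) by ring.
rewrite normrM [`|g n|]normrM mulrCA; apply: ler_wpM2l => //.
rewrite [`|_%:C|]ger0_norm ?ler0c ?mulr_ge0 ?sqr_ge0 ?expR_ge0 //.
have lh : `|lam n * h| <= (m n * k)%:C.
  by rewrite normrM hk real_complexM; apply: (ler_wpM2r _ (lamL n)); rewrite ler0c.
apply: le_trans (Cexp_sub1 lh) _; rewrite -real_complexM lecR.
have -> : 5 * (m n * k) ^+ 2 * expR (m n * k) = k ^+ 2 * (5 * m n ^+ 2 * expR (m n * k)).
  by ring.
apply: ler_wpM2l; first exact: sqr_ge0.
apply: ler_wpM2l; first by rewrite mulr_ge0 ?sqr_ge0.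
by rewrite ler_expR ler_piMr.
Qed.

Lemma derive1_zsum_exp :
  derive1 (fun h : C => zsum (fun n => c n * Cexp (lam n * h)) : C^o) 0 =
  zsum (fun n => c n * lam n).
Proof.
have [B B0 est] := zsum_exp_taylor.
pose F (h : R[i]) := zsum (fun n => c n * Cexp (lam n * h)).
pose D := zsum (fun n => c n * lam n).
rewrite /derive1; apply: cvg_lim; first exact: norm_hausdorff.
apply/cvgrPdist_le => e /complex_pos[d d0 ->].
have B1 : 0 < B + 1 by lra.
have dB : 0 < (d / (B + 1))%:C by rewrite ltcR divr_gt0.
near=> h.
have hn0 : h != 0 by near: h; exact: nbhs_dnbhs_neq.
have hd : `|h| <= (d / (B + 1))%:C by near: h; exact: dnbhs0_le.
have h1 : `|h| <= 1 by near: h; exact: dnbhs0_le.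
rewrite addr0 -normrN opprB.
have -> : (h^-1 *: ((F h : C^o) - F 0) - D : C^o) = h^-1 * (F h - F 0 - h * D).
  by rewrite [_ *: _]/(_ * _) [RHS]mulrBr mulKf.
rewrite normrM normfV.
have nh : 0 < `|h| by rewrite normr_gt0.
rewrite mulrC ler_pdivrMr //; apply: le_trans (est h h1) _.
rewrite expr2 -mulrA mulrC; apply: ler_wpM2r => //.
apply: (@le_trans _ _ ((d / (B + 1))%:C * B%:C)).
  by apply: (ler_wpM2r _ hd); rewrite ler0c.
rewrite -real_complexM lecR mulrAC ler_pdivrMr //; nra.
Unshelve. all: by end_near. Qed.

End TermwiseDerivative.

End ThetaSeries.

(** * Duplication formulas and behaviour at infinity *)

Section Taylor.
Variable R : realType.
Implicit Types (x y z tau : R[i]).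

(** Comparison of the coefficients of h in f(h) g(h) = c k(2h), where g and k vanish at 0. *)
Lemma taylor_product (f g k : R[i] -> R[i]) (c f0 f1 g1 k1 : R[i]) (B1 B2 B3 : R) :
  0 <= B1 -> 0 <= B2 -> 0 <= B3 ->
  (forall h, `|h| <= 1 -> `|f h - f0 - h * f1| <= `|h| ^+ 2 * B1%:C) ->
  (forall h, `|h| <= 1 -> `|g h - h * g1| <= `|h| ^+ 2 * B2%:C) ->
  (forall h, `|h| <= 1 -> `|k h - h * k1| <= `|h| ^+ 2 * B3%:C) ->
  (forall h, f h * g h = c * k (2 * h)) ->
  f0 * g1 = 2 * (c * k1).
Proof.
move=> B10 B20 B30 fT gT kT fgk.
apply/eqP; rewrite -subr_eq0 -normr_eq0 eq_le normr_ge0 andbT; apply/ler_addgt0Pl.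
move=> e /complex_pos[d d0 ->]; rewrite addr0.
pose a x := complex.Re `|x|.
have aE x : `|x| = (a x)%:C by rewrite /a normc_def.
have a0 x : 0 <= a x by rewrite -ler0c -aE.
(* The three summands of [e1] below are at most t^2 times these constants when |h| = t; dividing by
   t leaves an error t M, which the choice of t keeps below d. *)
pose M := (a f0 + a f1 + B1) * B2 + a g1 * (a f1 + B1) + 4 * (a c * B3).
have M0 : 0 <= M by rewrite !addr_ge0 ?mulr_ge0 ?addr_ge0.
pose t := Num.min (1 / 2) (d / (M + 1)).
have M1 : 0 < M + 1 by lra.
have t0 : 0 < t by rewrite lt_min divr_gt0 // divr_gt0.
have t2 : t <= 1 / 2 by rewrite ge_min lexx.
have tM : t * M <= d.
  have : t <= d / (M + 1) by rewrite ge_min lexx orbT.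
  rewrite ler_pdivlMr //; nra.
have tn : `|t%:C| = t%:C :> R[i] by rewrite ger0_norm // ler0c ltW.
have t1 : `|t%:C| <= 1 :> R[i] by rewrite tn lecR; lra.
have t22 : `|2 * t%:C| <= 1 :> R[i].
  rewrite normrM tn ger0_norm // (_ : 2 * t%:C = (2 * t)%:C).
    by rewrite lecR; lra.
  by rewrite real_complexM rmorph_nat.
set h : R[i] := t%:C in tn t1 t22.
have hn0 : h != 0 by rewrite -normr_eq0 tn (inj_eq (@complexI R)) gt_eqF.
have e1 : h * (f0 * g1 - 2 * (c * k1)) =
   c * (k (2 * h) - 2 * h * k1) - f h * (g h - h * g1) - h * g1 * (f h - f0).
  have := fgk h => e1; ring: e1.
have aM x y : a (x * y) = a x * a y.
  by apply: (@complexI R); rewrite real_complexM -!aE normrM.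
have aB x y : a (x - y) <= a x + a y.
  by rewrite -lecR real_complexD -!aE ler_normB.
have aD x y : a (x + y) <= a x + a y.
  by rewrite -lecR real_complexD -!aE ler_normD.
have le_a x (r s : R) : `|x| <= r%:C ^+ 2 * s%:C -> a x <= r ^+ 2 * s.
  by rewrite aE expr2 -!real_complexM lecR -expr2.
have ah : a h = t by rewrite /a tn.
have a2h : `|2 * h| = (2 * t)%:C.
  by rewrite normrM tn ger0_norm // real_complexM rmorph_nat.
have fh := fT h t1; rewrite tn in fh; have {}fh := le_a _ _ _ fh.
have gh := gT h t1; rewrite tn in gh; have {}gh := le_a _ _ _ gh.
have kh := kT (2 * h) t22; rewrite a2h in kh; have {}kh := le_a _ _ _ kh.
rewrite aE lecR.
have fd : a (f h - f0) <= t * (a f1 + B1).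
  have tB : t ^+ 2 * B1 <= t * B1.
    by rewrite expr2 -mulrA ler_piMl ?mulr_ge0 ?(ltW t0) //; lra.
  have := aD (f h - f0 - h * f1) (h * f1); rewrite subrK aM ah mulrDr; lra.
have fb : a (f h) <= a f0 + a f1 + B1.
  have tB : t * (a f1 + B1) <= a f1 + B1 by rewrite ler_piMl ?addr_ge0 //; lra.
  have := aD (f h - f0) f0; rewrite subrK; lra.
have := aB (c * (k (2 * h) - 2 * h * k1) - f h * (g h - h * g1)) (h * g1 * (f h - f0)).
have := aB (c * (k (2 * h) - 2 * h * k1)) (f h * (g h - h * g1)).
rewrite -e1 !aM ah.
have q1 : a c * a (k (2 * h) - 2 * h * k1) <= a c * ((2 * t) ^+ 2 * B3) by rewrite ler_wpM2l.
have q2 : a (f h) * a (g h - h * g1) <= (a f0 + a f1 + B1) * (t ^+ 2 * B2).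
  by rewrite ler_pM.
have q3 : t * a g1 * a (f h - f0) <= t * a g1 * (t * (a f1 + B1)).
  by rewrite ler_wpM2l ?mulr_ge0 // ltW.
move=> n1 n2.
have : t * a (f0 * g1 - 2 * (c * k1)) <= t * (t * M).
  apply: le_trans n2 _; apply: le_trans (lerD n1 q3) _.
  apply: le_trans (lerD (lerD q1 q2) (lexx _)) _.
  rewrite (_ : _ + _ = t * (t * M)) ?lexx // /M; ring.
by rewrite ler_pM2l // => /le_trans; apply.
Qed.

End Taylor.

Section ThetaConstants.
Variable R : realType.
Let C : numFieldType := R[i].
Implicit Types (a x y z tau : R[i]).

Lemma Im_double tau : 0 < complex.Im tau -> 0 < complex.Im (2 * tau).
Proof. by move=> t0; rewrite mulr2n mulrDl mul1r ImD addr_gt0. Qed.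

Definition theta11_der tau : R[i] :=
  zsum (fun n => theta_term (1 / 2) (1 / 2) tau n * (Cpi R * 'i * (2 * (n%:~R + 1 / 2)))).

Lemma thetac_exp a b z tau :
  thetac a (z + b) tau =
  zsum (fun n => theta_term a b tau n * Cexp (Cpi R * 'i * (2 * (n%:~R + a)) * z)).
Proof.
apply: eq_zsum => n; have -> : Cexp (Cpi R * 'i * (2 * (n%:~R + a)) * z) = ee (2 * (n%:~R + a) * z).
  by rewrite /ee; congr Cexp; ring.
by rewrite /theta_term -eeD; congr ee; ring.
Qed.

Lemma lam_bound (n : int) :
  `|Cpi R * 'i * (2 * (n%:~R + 1 / 2)) : R[i]| <= (2 * pi * ((absz n)%:R + 1))%:C.
Proof.
have i1 : `|'i : R[i]| = 1 by rewrite normc_def /= expr0n /= add0r expr1n sqrtr1.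
rewrite normrM normrM i1 mulr1 ger0_norm ?ler0c ?pi_ge0 //.
rewrite [2 * pi]mulrC -mulrA real_complexM; apply: ler_wpM2l; first by rewrite ler0c pi_ge0.
rewrite real_complexM rmorph_nat normrM ger0_norm //; apply: ler_wpM2l => //.
apply: le_trans (ler_normD _ _) _; rewrite real_complexD rmorph_nat; apply: lerD.
  by rewrite -intr_norm -abszE.
rewrite ger0_norm ?divr_ge0 // div1r invf_le1 // ler1n //.
Qed.

Lemma dtheta11E tau : 0 < complex.Im tau -> dtheta11 tau = theta11_der tau.
Proof.
move=> t0; have al0 : 0 < pi * complex.Im tau by rewrite mulr_gt0 // pi_gt0.
have L0 : 0 <= 2 * pi :> R by rewrite mulr_ge0 // pi_ge0.
rewrite /theta11_der -(derive1_zsum_exp al0 L0 (theta_term_gauss _ _ _) lam_bound).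
rewrite /dtheta11.
by under eq_fun => z do rewrite theta_thetac thetac_exp.
Qed.

Lemma theta11_taylor tau : 0 < complex.Im tau ->
  exists2 B : R, 0 <= B & forall h : R[i], `|h| <= 1 ->
    `|thetac (1 / 2) (h + 1 / 2) tau - h * theta11_der tau| <= `|h| ^+ 2 * B%:C.
Proof.
move=> t0; have al0 : 0 < pi * complex.Im tau by rewrite mulr_gt0 // pi_gt0.
have L0 : 0 <= 2 * pi :> R by rewrite mulr_ge0 // pi_ge0.
have [B B0 hB] := zsum_exp_taylor al0 L0 (theta_term_gauss (1/2) (1/2) tau) lam_bound.
exists B => // h h1; have := hB h h1.
by rewrite -!thetac_exp add0r thetac_half_half // subr0.
Qed.

(** The slope stays existential: it is multiplied by theta_11(0) = 0 in the comparison of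
    first-order terms. *)
Lemma theta10_taylor tau : 0 < complex.Im tau ->
  exists f1 : R[i], exists2 B : R, 0 <= B & forall h : R[i], `|h| <= 1 ->
    `|thetac (1 / 2) h tau - thetac (1 / 2) 0 tau - h * f1| <= `|h| ^+ 2 * B%:C.
Proof.
move=> t0; have al0 : 0 < pi * complex.Im tau by rewrite mulr_gt0 // pi_gt0.
have L0 : 0 <= 2 * pi :> R by rewrite mulr_ge0 // pi_ge0.
have [B B0 hB] := zsum_exp_taylor al0 L0 (theta_term_gauss (1/2) 0 tau) lam_bound.
eexists; exists B => // h h1; have := hB h h1.
by rewrite -!thetac_exp !addr0 => H; exact: H.
Qed.

Section Doubling.
Variable tau : R[i].
Hypothesis tau0 : 0 < complex.Im tau.
Let sig := 2 * tau.
Let sig0 : 0 < complex.Im sig := Im_double tau0.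

Let half2 : 1 / 2 + 1 / 2 = 1 :> R[i].
Proof. by field. Qed.

Let T1 z : thetac 1 z sig = thetac 0 z sig.
Proof. by rewrite -[1]add0r thetac_succ. Qed.

Let Tm a z : thetac a (z - 1 / 2) sig = ee (- (2 * a)) * thetac a (z + 1 / 2) sig.
Proof.
have -> : z + 1 / 2 = (z - 1 / 2) + 1 by field.
by rewrite thetac_add1 // mulrA -eeD addNr ee0 [RHS]mul1r.
Qed.

Let T0_half : thetac 0 (0 - 1 / 2) sig = thetac 0 (1 / 2) sig.
Proof. by rewrite Tm mulr0 oppr0 ee0 [LHS]mul1r add0r. Qed.

Let Th_half : thetac (1 / 2) (0 - 1 / 2) sig = 0.
Proof. by rewrite Tm add0r thetac_half_half // mulr0. Qed.

Lemma theta00_theta01_double : thetac 0 0 tau * thetac 0 (1 / 2) tau = thetac 0 (1 / 2) sig ^+ 2.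
Proof. by rewrite thetac_mul // -/sig T0_half Th_half mulr0 addr0 add0r expr2. Qed.

Lemma theta10_double : thetac (1 / 2) 0 tau ^+ 2 = 2 * (thetac 0 0 sig * thetac (1 / 2) 0 sig).
Proof. by rewrite expr2 thetac_mul // -/sig half2 T1 addr0 subr0; ring. Qed.

(** The two arguments differ by a constant, so each product on the right has a constant factor. In
    the second product it is theta_11(0 | 2 tau) = 0 up to a unit, which leaves a single term. *)
Lemma theta10_theta11_double z :
  thetac (1 / 2) z tau * thetac (1 / 2) (z + 1 / 2) tau =
  thetac 0 (1 / 2) sig * thetac (1 / 2) (2 * z + 1 / 2) sig.
Proof.
rewrite thetac_mul // -/sig half2.
have -> : z - (z + 1 / 2) = 0 - 1 / 2 by ring.
have -> : z + (z + 1 / 2) = 2 * z + 1 / 2 by ring.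
by rewrite T0_half Th_half mulr0 addr0 mulrC.
Qed.

Lemma theta11_der_double :
  thetac (1 / 2) 0 tau * theta11_der tau = 2 * (thetac 0 (1 / 2) sig * theta11_der sig).
Proof.
have [f1 [B1 B10 h1]] := theta10_taylor tau0.
have [B2 B20 h2] := theta11_taylor tau0.
have [B3 B30 h3] := theta11_taylor sig0.
exact: taylor_product B10 B20 B30 h1 h2 h3 theta10_theta11_double.
Qed.

Lemma thetac_sqr z (A := thetac 0 0 sig) (B := thetac (1 / 2) 0 sig)
    (X := thetac 0 (2 * z) sig) (Y := thetac (1 / 2) (2 * z) sig) :
  [/\ thetac 0 z tau ^+ 2 = A * X + B * Y,
      thetac 0 (z + 1 / 2) tau ^+ 2 = A * X - B * Y,
      thetac (1 / 2) z tau ^+ 2 = B * X + A * Y &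
      thetac (1 / 2) (z + 1 / 2) tau ^+ 2 = B * X - A * Y].
Proof.
have e : z + 1 / 2 + (z + 1 / 2) = 2 * z + 1 by field.
have sqE a x : thetac a x tau ^+ 2 = thetac a (x + x) sig * A + thetac (a + 1 / 2) (x + x) sig * B.
  by rewrite expr2 thetac_mul // subrr.
have zz : z + z = 2 * z by ring.
have T0e : thetac 0 (2 * z + 1) sig = X by rewrite thetac_add1 // mulr0 ee0 [LHS]mul1r.
have The : thetac (1 / 2) (2 * z + 1) sig = - Y.
  have h : 2 * (1 / 2) = 1 :> R[i] by field.
  by rewrite thetac_add1 // h ee1 mulN1r.
split.
- by rewrite sqE zz add0r /X /Y; ring.
- by rewrite sqE e add0r T0e The /X /Y; ring.
- by rewrite sqE zz half2 (T1 (2 * z)) /X /Y; ring.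
- by rewrite sqE e half2 (T1 (2 * z + 1)) T0e The /X /Y; ring.
Qed.

End Doubling.

(** At z = 0 the squares become A^2 + B^2, A^2 - B^2 and 2AB, so each relation is a polynomial
    identity in A, B, X, Y. *)
Lemma theta_quadratic tau z : 0 < complex.Im tau ->
  [/\ thetac (1 / 2) 0 tau ^+ 2 * thetac 0 z tau ^+ 2 =
        thetac 0 0 tau ^+ 2 * thetac (1 / 2) z tau ^+ 2
        + thetac 0 (1 / 2) tau ^+ 2 * thetac (1 / 2) (z + 1 / 2) tau ^+ 2,
      thetac (1 / 2) 0 tau ^+ 2 * thetac 0 (z + 1 / 2) tau ^+ 2 =
        thetac 0 (1 / 2) tau ^+ 2 * thetac (1 / 2) z tau ^+ 2
        + thetac 0 0 tau ^+ 2 * thetac (1 / 2) (z + 1 / 2) tau ^+ 2 &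
      thetac 0 0 tau ^+ 2 * thetac 0 (z + 1 / 2) tau ^+ 2 =
        thetac 0 (1 / 2) tau ^+ 2 * thetac 0 z tau ^+ 2
        + thetac (1 / 2) 0 tau ^+ 2 * thetac (1 / 2) (z + 1 / 2) tau ^+ 2].
Proof.
move=> t0.
have [-> -> -> ->] := thetac_sqr t0 z.
have [-> + -> _] := thetac_sqr t0 0; rewrite add0r => ->; rewrite mulr0.
by move: (thetac _ _ _) (thetac _ _ _) (thetac _ _ _) (thetac _ _ _) => A B X Y; split; ring.
Qed.

Section Asymptotics.
Variable tau : R[i].
Hypothesis tau0 : 0 < complex.Im tau.
(* [rho = |exp(pi i tau)|] *)
Let rho : R := expR (- (pi * complex.Im tau)).
Hypothesis rho2 : rho <= 1 / 2.

Let rho0 : 0 <= rho := expR_ge0 _.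
Let rho1 : rho <= 1.
Proof. by apply: le_trans rho2 _; lra. Qed.

Let ee_nat (m : nat) : `|ee (m%:R * tau)| = (rho ^+ m)%:C.
Proof.
have mC : m%:R = (m%:R : R)%:C :> R[i] by rewrite rmorph_nat.
rewrite ee_norm mC ImMr.
by rewrite /rho -expRM_natl; congr (expR _)%:C; ring.
Qed.

Let ee_real (r : R) : `|ee r%:C| = 1.
Proof. by rewrite ee_norm /= mulr0 oppr0 expR0. Qed.

Let pow_le (m n : nat) : (n <= m)%N -> rho ^+ m <= rho ^+ n.
Proof. by move=> nm; rewrite ler_wiXn2l. Qed.

Lemma theta0_near (s : R) : `|thetac 0 s%:C tau - 1| <= (5 * rho)%:C.
Proof.
have termE (n : int) : theta_term 0 s%:C tau n =
    ee ((absz n ^ 2)%:R * tau) * ee (2 * n%:~R * s)%:C.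
  have -> : (absz n ^ 2)%:R = n%:~R ^+ 2 :> R[i].
    by rewrite natrX; case: n => n //; rewrite NegzE mulrNz sqrrN.
  rewrite /theta_term addr0 -eeD; congr ee.
  by rewrite !real_complexM rmorph_nat rmorph_int.
have nE n : `|theta_term 0 s%:C tau n| = (rho ^+ (absz n ^ 2))%:C.
  by rewrite termE normrM ee_nat ee_real mulr1.
have bnd : `|thetac 0 s%:C tau - (theta_term 0 s%:C tau 0 + theta_term 0 s%:C tau (-1))| <=
    (4 * 1 * rho)%:C.
  apply: zsum_bound; [by rewrite rho0|exact: theta_term_decay|].
  by move=> n n0; rewrite !nE !mul1r !lecR; split; apply: pow_le => //=; nia.
have t00 : theta_term 0 s%:C tau 0 = 1.
  by rewrite /theta_term mulr0z addr0 expr0n /= mul0r mulr0 mul0r addr0 ee0.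
have tm1 := nE (-1); rewrite expr1 in tm1.
have -> : thetac 0 s%:C tau - 1 = thetac 0 s%:C tau -
    (theta_term 0 s%:C tau 0 + theta_term 0 s%:C tau (-1)) + theta_term 0 s%:C tau (-1).
  by rewrite t00; ring.
apply: le_trans (ler_normD _ _) _.
(* 4 from the tail and 1 from the term n = -1, which has modulus [rho]. *)
have -> : (5 * rho)%:C = (4 * 1 * rho)%:C + rho%:C by rewrite -real_complexD; congr _%:C; ring.
by apply: lerD => //; rewrite tm1.
Qed.

(** As (n + 1/2)^2 = n (n + 1) + 1/4, this is the exponent left once exp(pi i tau / 4) is factored
    out. It vanishes exactly at n = 0 and n = -1, the two leading terms. *)
Let mm (n : int) : nat := absz (n * (n + 1)).

Let mmE n : (mm n)%:R = n%:~R * (n%:~R + 1) :> R[i].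
Proof.
have : (mm n : int) = n * (n + 1) by rewrite /mm; case: n => n; lia.
by move=> /(congr1 (fun k : int => k%:~R : R[i])) /=; rewrite intrM intrD.
Qed.

Let half_termE (z : R[i]) (n : int) : ee (- (tau / 4)) * theta_term (1 / 2) z tau n =
  ee ((mm n)%:R * tau) * ee (2 * (n%:~R + 1 / 2) * z).
Proof. by rewrite mmE /theta_term -!eeD; congr ee; field. Qed.

Let half_near (kap : int -> R[i]) (K : R) : 0 <= K ->
  geo_decay (fun n => ee ((mm n)%:R * tau) * kap n) ->
  (forall n, `|kap n| <= (K * ((absz n)%:R + 1))%:C) ->
  `|zsum (fun n => ee ((mm n)%:R * tau) * kap n) - (kap 0 + kap (-1))| <= (8 * K * rho)%:C.
Proof.
move=> K0 fd kapK.
(* [mm] is at least 2n at [Posz n] and [Negz n] for n > 0: one factor rho^n absorbs the linear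
   growth of [kap], and the other gives the geometric bound. *)
have pow2 (n : nat) : (n%:R + 2) * rho ^+ n <= 2.
  apply: (@le_trans _ _ (2 * 2 ^+ n * rho ^+ n)).
    apply: ler_wpM2r; first by rewrite exprn_ge0.
    rewrite -natrD -exprS -natrX ler_nat; elim: n => // n IH.
    by rewrite expnS; lia.
  rewrite -mulrA ler_piMr // -exprMn exprn_ile1 //; first by rewrite mulr_ge0.
  by move: rho2; lra.
have -> : kap 0 + kap (-1) = ee ((mm 0)%:R * tau) * kap 0 + ee ((mm (-1))%:R * tau) * kap (-1).
  by rewrite !mul0r ee0 !mul1r.
have -> : 8 * K * rho = 4 * (2 * K) * rho by ring.
apply: zsum_bound; [by rewrite rho0|exact: fd|].
have bnd (m n : nat) (x : R[i]) : (n + n <= m)%N -> `|x| <= (K * (n%:R + 2))%:C ->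
    `|ee (m%:R * tau) * x| <= (2 * K * rho ^+ n)%:C.
  move=> nm xK; rewrite normrM ee_nat.
  apply: (@le_trans _ _ ((rho ^+ m)%:C * (K * (n%:R + 2))%:C)).
    by apply: ler_wpM2l => //; rewrite ler0c exprn_ge0.
  rewrite -real_complexM lecR.
  apply: (@le_trans _ _ (rho ^+ (n + n) * (K * (n%:R + 2)))).
    by apply: ler_wpM2r; [rewrite mulr_ge0 ?addr_ge0|exact: pow_le].
  have := ler_wpM2l (mulr_ge0 K0 (exprn_ge0 n rho0)) (pow2 n).
  by rewrite exprD; lra.
move=> n n0; split.
  apply: bnd; first by rewrite /mm; nia.
  by apply: le_trans (kapK _) _; rewrite lecR ler_wpM2l //= lerD2l; lra.
apply: bnd; first by rewrite /mm; nia.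
apply: le_trans (kapK _) _; rewrite lecR ler_wpM2l //=.
by rewrite -[n.+1%:R]natr1; lra.
Qed.

Lemma theta10_near : `|ee (- (tau / 4)) * thetac (1 / 2) 0 tau - 2| <= (8 * 1 * rho)%:C.
Proof.
have td : geo_decay (theta_term (1 / 2) 0 tau) by exact: theta_term_decay.
have E n : ee (- (tau / 4)) * theta_term (1 / 2) 0 tau n = ee ((mm n)%:R * tau) * 1.
  by rewrite half_termE mulr0 ee0.
rewrite /thetac -zsumZ // (eq_zsum E).
have -> : 2 = (fun _ : int => 1 : R[i]) 0 + (fun _ : int => 1 : R[i]) (-1) by [].
apply: half_near => //; first by rewrite -(funext E); exact: geo_decayZ.
by move=> n; rewrite normr1 mul1r lecR lerDr.
Qed.

(** The terms n = 0 and n = -1 each contribute - pi. Divided by the limit 2 of theta_10 with the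
    same normalisation, their sum gives the constant - pi in Jacobi's formula. *)
Lemma theta11_der_near :
  `|ee (- (tau / 4)) * theta11_der tau + 2 * Cpi R| <= (8 * (2 * pi) * rho)%:C.
Proof.
pose lam (n : int) : R[i] := Cpi R * 'i * (2 * (n%:~R + 1 / 2)).
pose kap (n : int) := ee (2 * (n%:~R + 1 / 2) * (1 / 2)) * lam n.
have al0 : 0 < pi * complex.Im tau by rewrite mulr_gt0 // pi_gt0.
have L0 : 0 <= 2 * pi :> R by rewrite mulr_ge0 // pi_ge0.
have td : geo_decay (fun n => theta_term (1 / 2) (1 / 2) tau n * lam n).
  exact: (zsum_lam_decay al0 (theta_term_gauss _ _ _) lam_bound).
have E n : ee (- (tau / 4)) * (theta_term (1 / 2) (1 / 2) tau n * lam n) =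
    ee ((mm n)%:R * tau) * kap n.
  by rewrite mulrA half_termE /kap mulrA.
have i2 : 'i * 'i = -1 :> R[i] by rewrite -expr2 sqr_i.
have k0 : kap 0 = - Cpi R.
  rewrite /kap /lam mulr0z add0r.
  have -> : 2 * (1 / 2) = 1 :> R[i] by field.
  rewrite mul1r mulr1 ee_half -?complexiE mulrC -mulrA.
  by rewrite i2 mulrN1.
have k1 : kap (-1) = - Cpi R.
  rewrite /kap /lam.
  have -> : (-1)%:~R + 1 / 2 = - (1 / 2) :> R[i] by rewrite mulrNz; field.
  have -> : 2 * (- (1 / 2)) = - 1 :> R[i] by field.
  rewrite mulN1r eeN ee_half -?complexiE mulrN1.
  have -> : ('i)^-1 = - 'i :> R[i].
    have i0 : 'i != 0 :> R[i].
      by first [exact: neq0Ci | rewrite eq_complex /= oner_eq0 andbF].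
    by apply: (mulfI i0); rewrite mulfV // mulrN i2 opprK.
  by rewrite mulrNN mulrC -mulrA i2 mulrN1.
rewrite /theta11_der -zsumZ // (eq_zsum E).
have -> : 2 * Cpi R = - (kap 0 + kap (-1)) by rewrite k0 k1; ring.
apply: half_near => //; first by rewrite -(funext E); exact: geo_decayZ.
have hC : (1 / 2 : R)%:C = 1 / 2 :> R[i] by rewrite !div1r [LHS]fmorphV rmorph_nat.
move=> n; rewrite /kap normrM.
have -> : 2 * (n%:~R + 1 / 2) * (1 / 2) = (n%:~R + 1 / 2 : R)%:C :> R[i].
  by rewrite real_complexD hC rmorph_int; field.
by rewrite ee_real mul1r; exact: lam_bound.
Qed.
End Asymptotics.

End ThetaConstants.

(** * Jacobi's derivative formula and the Lax coefficients *)

Section ThetaConstantsFinal.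
Variable R : realType.
Let C : numFieldType := R[i].
Implicit Types (z tau : R[i]).

Section Descent.
Variable tau : R[i].
Hypothesis tau0 : 0 < complex.Im tau.

Let tk (k : nat) : R[i] := 2 ^+ k * tau.
Let rho : R := expR (- (pi * complex.Im tau)).
Let rk (k : nat) : R := expR (- (pi * complex.Im (tk k))).

Let ImtkE k : complex.Im (tk k) = 2 ^+ k * complex.Im tau.
Proof.
elim: k => [|k IH]; first by rewrite /tk !expr0 !mul1r.
have -> : tk k.+1 = tk k + tk k by rewrite /tk exprS; ring.
by rewrite ImD IH exprS; ring.
Qed.

Let tk0 k : 0 < complex.Im (tk k).
Proof. by rewrite ImtkE mulr_gt0 // exprn_gt0. Qed.

Let tkS k : tk k.+1 = 2 * tk k.
Proof. by rewrite /tk exprS mulrA. Qed.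

Let rk_le k : rk k <= rho ^+ k.
Proof.
rewrite /rk /rho -expRM_natl ler_expR ImtkE mulrN lerN2 [X in _ <= X]mulrCA.
apply: ler_wpM2r; first by rewrite mulr_ge0 ?pi_ge0 // ltW.
by rewrite -natrX ler_nat ltnW // ltn_expl.
Qed.

Let rho_cvg : (rho ^+ k) @[k --> \oo] --> (0 : R).
Proof.
have : (geometric 1 rho) @ \oo --> (0 : R).
  apply: cvg_geometric; rewrite ger0_norm ?expR_ge0 // -[X in _ < X](@expR0 R).
  by rewrite ltr_expR oppr_lt0 mulr_gt0 // pi_gt0.
by rewrite (_ : geometric 1 rho = (fun k => rho ^+ k)) //; apply/funext => k; rewrite /= mul1r.
Qed.

(** The asymptotic estimates require [rk k <= 1 / 2], which holds for all large k. *)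
Let near_cvg (u : nat -> R[i]) (l : R[i]) (K : R) : 0 <= K ->
  (forall k, rk k <= 1 / 2 -> `|u k - l| <= (K * rk k)%:C) ->
  (u k : C^o) @[k --> \oo] --> (l : C^o).
Proof.
move=> K0 uK; apply/cvgrPdist_le => e /complex_pos[d d0 ->].
have half0 : 0 < 1 / 2 :> R by lra.
have dK : 0 < d / (K + 1) by rewrite divr_gt0 // ltr_wpDl.
have small (b : R) : 0 < b -> \forall k \near \oo, rk k <= b.
  move=> b0; move/cvgrPdist_le : rho_cvg => /(_ _ b0) h; near=> k.
  apply: le_trans (rk_le k) _.
  have : `|0 - rho ^+ k| <= b by near: k.
  by rewrite sub0r normrN; apply: le_trans; rewrite ler_norm.
near=> k; rewrite -normrN opprB; apply: le_trans (uK k _) _.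
  by near: k; exact: small.
rewrite lecR; have : rk k <= d / (K + 1) by near: k; exact: small.
have r0 : 0 <= rk k := expR_ge0 _.
rewrite ler_pdivlMr ?ltr_wpDl //; nra.
Unshelve. all: by end_near. Qed.

Let near_neq0 (u : nat -> R[i]) (l : R[i]) : l != 0 ->
  (u k : C^o) @[k --> \oo] --> (l : C^o) -> \forall k \near \oo, u k != 0.
Proof.
move=> l0 /cvgrPdist_lt ul; have nl : 0 < `|l| by rewrite normr_gt0.
have {}ul := ul _ nl; near=> k; apply/eqP => uk0.
have : `|l - u k| < `|l| by near: k.
by rewrite uk0 subr0 ltxx.
Unshelve. all: by end_near. Qed.

Let t0r (x : R[i]) (r : R) : x = r%:C -> (thetac 0 x (tk k) : C^o) @[k --> \oo] --> (1 : C^o).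
Proof.
by move=> ->; apply: (near_cvg (K := 5)) => // k rk2; exact: theta0_near.
Qed.

Let half_cvg00 : (thetac 0 0 (tk k) : C^o) @[k --> \oo] --> (1 : C^o).
Proof. exact: (t0r (r := 0)). Qed.

Let half_cvg01 : (thetac 0 (1 / 2) (tk k) : C^o) @[k --> \oo] --> (1 : C^o).
Proof. by apply: (t0r (r := 1 / 2)); rewrite !div1r [RHS]fmorphV rmorph_nat. Qed.

Let half_cvg10 : (ee (- (tk k / 4)) * thetac (1 / 2) 0 (tk k) : C^o) @[k --> \oo] --> (2 : C^o).
Proof. by apply: (near_cvg (K := 8 * 1)) => // k rk2; exact: theta10_near. Qed.

Let half_cvg11 :
  (ee (- (tk k / 4)) * theta11_der (tk k) : C^o) @[k --> \oo] --> (- (2 * Cpi R) : C^o).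
Proof.
apply: (near_cvg (K := 8 * (2 * pi))) => [|k rk2]; first by rewrite !mulr_ge0 ?pi_ge0.
by rewrite opprK; exact: theta11_der_near.
Qed.

Let nonzero k :=
  [&& thetac 0 0 (tk k) != 0, thetac 0 (1 / 2) (tk k) != 0 & thetac (1 / 2) 0 (tk k) != 0].

(* The duplication formulas carry non-vanishing from 2 tau down to tau. *)
Let nonzero_descent k : nonzero k.+1 -> nonzero k.
Proof.
rewrite /nonzero tkS => /and3P[h00 h01 h10].
have : thetac 0 0 (tk k) * thetac 0 (1 / 2) (tk k) != 0.
  by rewrite (theta00_theta01_double (tk0 k)) expf_neq0.
rewrite mulf_eq0 negb_or => /andP[-> ->] /=.
have : thetac (1 / 2) 0 (tk k) ^+ 2 != 0.
  by rewrite (theta10_double (tk0 k)) !mulf_neq0 // pnatr_eq0.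
by rewrite expf_eq0.
Qed.

(** The limits 1, 1 and 2 are nonzero, so the claim holds from some N on; descent then leads from k
    + N to k. The value theta_10 itself tends to 0, hence its exponential normalisation. *)
Let nonzero_all k : nonzero k.
Proof.
have [N hN] : exists N, forall n, (N <= n)%N -> nonzero n.
  have : \forall n \near \oo, nonzero n.
    near=> n; apply/and3P; split.
    - by near: n; apply: near_neq0 half_cvg00; exact: oner_neq0.
    - by near: n; apply: near_neq0 half_cvg01; exact: oner_neq0.
    - have : ee (- (tk n / 4)) * thetac (1 / 2) 0 (tk n) != 0.
        by near: n; apply: near_neq0 half_cvg10; rewrite pnatr_eq0.
      by rewrite mulf_eq0 negb_or => /andP[].
  by case=> N _ h; exists N.
have desc d : nonzero (k + d) -> nonzero k.
  elim: d => [|d IH]; first by rewrite addn0.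
  by rewrite addnS => /nonzero_descent.
by apply: (desc N); apply: hN; rewrite leq_addl.
Unshelve. all: by end_near. Qed.

Lemma theta_constants_neq0 :
  [/\ thetac 0 0 tau != 0, thetac 0 (1 / 2) tau != 0 & thetac (1 / 2) 0 tau != 0].
Proof. by apply/and3P; have := nonzero_all 0; rewrite /nonzero /tk expr0 mul1r. Qed.

(* Jacobi's derivative formula: the quotient of the two sides is invariant
   under tau -> 2 tau, so it equals its limit at infinity. *)
Lemma theta11_derE :
  theta11_der tau = - Cpi R * (thetac 0 0 tau * thetac 0 (1 / 2) tau * thetac (1 / 2) 0 tau).
Proof.
pose N k := thetac 0 0 (tk k) * thetac 0 (1 / 2) (tk k) * thetac (1 / 2) 0 (tk k).
have tk00 : tk 0 = tau by rewrite /tk expr0 mul1r.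
have /and3P[n00 n01 n10] := nonzero_all 0.
have N0 : N 0%N != 0 by rewrite !mulf_neq0.
pose c := theta11_der tau / N 0%N.
have DE k : theta11_der (tk k) = c * N k.
  elim: k => [|k IH]; first by rewrite /c divfK // tk00.
  have /and3P[a00 a01 a10] := nonzero_all k.
  have /and3P[b00 b01 b10] := nonzero_all k.+1.
  have d1 := theta11_der_double (tk0 k); have d2 := theta00_theta01_double (tk0 k).
  have d3 := theta10_double (tk0 k); rewrite -tkS in d1 d2 d3.
  have c0 : 2 * thetac 0 (1 / 2) (tk k.+1) != 0 by rewrite mulf_neq0 // pnatr_eq0.
  apply: (mulfI c0); rewrite -mulrA -d1 IH /N d2.
  (* Both sides reduce to this mixed expression in tau and 2 tau, by one duplication formula
     each. *)
  transitivity (c * thetac 0 (1 / 2) (tk k.+1) ^+ 2 * thetac (1 / 2) 0 (tk k) ^+ 2).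
    by rewrite -d2; ring.
  by rewrite d3; ring.
have lim : (ee (- (tk k / 4)) * theta11_der (tk k) : C^o) @[k --> \oo] -->
    (c * (1 * 1 * 2) : C^o).
  have -> : (fun k => ee (- (tk k / 4)) * theta11_der (tk k) : C^o) =
    (fun k => (c : C^o) * ((thetac 0 0 (tk k) : C^o) * (thetac 0 (1 / 2) (tk k) : C^o)
       * (ee (- (tk k / 4)) * thetac (1 / 2) 0 (tk k) : C^o))).
    by apply/funext => k; rewrite DE /N; ring.
  apply: (cvgM (cvg_cst _)); apply: cvgM half_cvg10.
  exact: cvgM half_cvg00 half_cvg01.
have cE : c * (1 * 1 * 2) = - (2 * Cpi R).
  exact: (@cvg_unique _ (@norm_hausdorff C C^o) _ _ _ _ lim half_cvg11).
have -> : - Cpi R = c.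
  have two0 : 2 != 0 :> R[i] by rewrite pnatr_eq0.
  by apply: (mulfI two0); rewrite mulrN -cE; ring.
by have := DE 0%N; rewrite tk00 /N tk00.
Qed.

End Descent.

Section LaxCoefficients.
Variables tau z : R[i].
Hypothesis tau0 : 0 < complex.Im tau.

Let N00 := thetac 0 0 tau.
Let N01 := thetac 0 (1 / 2) tau.
Let N10 := thetac (1 / 2) 0 tau.
Let th11 := thetac (1 / 2) (z + 1 / 2) tau.

Let thetaE (a b : nat) (x : R[i]) : theta a b x tau = thetac (a%:R / 2) (x + b%:R / 2) tau.
Proof. exact: theta_thetac. Qed.

Let cpi_neq0 : Cpi R != 0.
Proof. by rewrite /Cpi (inj_eq (@complexI R) _ 0) gt_eqF // pi_gt0. Qed.

Let shift1 x : thetac (1 / 2) (1 / 2 + x + 1 / 2) tau = - thetac (1 / 2) x tau.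
Proof.
have -> : 1 / 2 + x + 1 / 2 = x + 1 by field.
have h : 2 * (1 / 2) = 1 :> R[i] by field.
by rewrite thetac_add1 // h ee1 mulN1r.
Qed.

Let T1 x : thetac 1 x tau = thetac 0 x tau.
Proof. by rewrite -[1]add0r thetac_succ. Qed.

Let shift_tau x : thetac (1 / 2) (tau / 2 + x + 1 / 2) tau =
  ee (- (tau / 4) - 1 / 2) * ee (- x) * thetac 0 (x + 1 / 2) tau.
Proof.
have -> : tau / 2 + x + 1 / 2 = (x + 1 / 2) + 1 / 2 * tau by field.
have h : 1 / 2 + 1 / 2 = 1 :> R[i] by field.
by rewrite thetac_add_tau // h (T1 (x + 1 / 2)) -eeD; congr (ee _ * _); field.
Qed.

Let shift_1tau x : thetac (1 / 2) ((1 + tau) / 2 + x + 1 / 2) tau =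
  ee (- (tau / 4) - 1) * ee (- x) * thetac 0 x tau.
Proof.
have -> : (1 + tau) / 2 + x + 1 / 2 = (x + 1) + 1 / 2 * tau by field.
have h : 1 / 2 + 1 / 2 = 1 :> R[i] by field.
rewrite thetac_add_tau // h (T1 (x + 1)) thetac_add1 // mulr0 ee0 [X in _ * X]mul1r -eeD.
by congr (ee _ * _); field.
Qed.

(** [N] is the theta constant produced by theta_11 at the half period; it cancels one of the three
    in theta_11'(0). The factor pi cancels too, and 1/i squares to -1. *)
Let coefE (Z M N : R[i]) : N != 0 -> th11 != 0 ->
  (Z * (- Cpi R * (N * M)) / (N * th11) / (Cpi R * 'i)) ^+ 2 = - (Z * M / th11) ^+ 2.
Proof.
move=> N0 t0.
have i0 : 'i != 0 :> R[i].
  by first [exact: neq0Ci | rewrite eq_complex /= oner_eq0 andbF].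
have gen (p i t : R[i]) : p != 0 -> i != 0 -> t != 0 ->
    Z * (- p * (N * M)) / (N * t) / (p * i) = - (Z * M / t) * i^-1.
  by move=> p0 ii0 tt0; field; rewrite N0 p0 ii0 tt0.
by rewrite (gen _ _ _ cpi_neq0 i0 t0) exprMn sqrrN exprVn sqr_i invrN1 mulrN1.
Qed.

Lemma lax_coef_sqr : th11 != 0 ->
  [/\ lax_coef tau z 1 ^+ 2 = - (thetac 0 (z + 1 / 2) tau * (N00 * N10) / th11) ^+ 2,
      lax_coef tau z 2 ^+ 2 = (thetac 0 z tau * (N01 * N10) / th11) ^+ 2 &
      lax_coef tau z 3 ^+ 2 = - (thetac (1 / 2) z tau * (N00 * N01) / th11) ^+ 2].
Proof.
move=> t0; have [n00 n01 n10] := theta_constants_neq0 tau0.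
have phiE w : phi tau w z = thetac (1 / 2) (w + z + 1 / 2) tau * (- Cpi R * (N00 * N01 * N10))
    / (thetac (1 / 2) (w + 0 + 1 / 2) tau * th11).
  by rewrite /phi !thetaE dtheta11E // theta11_derE // addr0.
(* [e] is the factor exp(pi i z) of the Lax matrix, which offsets the quasi-periodicity factor exp(-
   pi i z); [e'] is the constant common to the shifts at z and at 0. *)
have cancel (e e' x p N M : R[i]) : e != 0 -> e' != 0 -> N != 0 ->
    e * (e' * e^-1 * x * (p * (N * M)) / (e' * N * th11)) = x * (p * (N * M)) / (N * th11).
  by move=> e0 e'0 N0; field; rewrite e0 e'0 N0 t0.
have cancelN (x p N M : R[i]) : N != 0 ->
    - x * (p * (N * M)) / (- N * th11) = x * (p * (N * M)) / (N * th11).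
  by move=> N0; field; rewrite N0 t0.
split.
- rewrite -(coefE _ _ n01 t0) /lax_coef /= phiE !shift_tau oppr0 ee0 mulr1 add0r.
  have -> : N00 * N01 * N10 = N01 * (N00 * N10) by ring.
  by rewrite -[Cexp _]/(ee z) eeN cancel // ee_neq0.
- rewrite -[RHS]opprK -(coefE _ _ n00 t0) /lax_coef /= phiE !shift_1tau oppr0 ee0 mulr1.
  have -> : N00 * N01 * N10 = N00 * (N01 * N10) by ring.
  rewrite exprMn sqrrN sqr_i mulN1r; congr (- _); congr (_ ^+ 2).
  by rewrite -[Cexp _]/(ee z) eeN cancel // ee_neq0.
- rewrite -(coefE _ _ n10 t0) /lax_coef /= phiE !shift1.
  have -> : N00 * N01 * N10 = N10 * (N00 * N01) by ring.
  by rewrite cancelN.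
Qed.

(** After clearing theta_11(z)^2, each equation is one of the three quadratic relations multiplied
    by the square of the theta constant on its left side. *)
Lemma lax_coef_relations : theta 1 1 z tau != 0 ->
  [/\ theta0 0 1 tau ^+ 4 = lax_coef tau z 3 ^+ 2 + lax_coef tau z 2 ^+ 2,
      theta0 0 0 tau ^+ 4 = lax_coef tau z 3 ^+ 2 - lax_coef tau z 1 ^+ 2 &
      theta0 1 0 tau ^+ 4 = - lax_coef tau z 2 ^+ 2 - lax_coef tau z 1 ^+ 2].
Proof.
rewrite /theta0 !thetaE !mul0r !add0r => t0.
have [-> -> ->] := lax_coef_sqr t0.
have [Q1 Q2 Q3] := theta_quadratic z tau0.
move: t0 Q1 Q2 Q3; rewrite -/N00 -/N01 -/N10 -/th11.
move: (thetac 0 z tau) (thetac 0 (z + 1 / 2) tau) (thetac (1 / 2) z tau) th11 N00 N01 N10.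
move=> z00 z01 z10 t a b c t0 Q1 Q2 Q3.
have solve (x y : R[i]) : x * t ^+ 2 = y -> x = y / t ^+ 2.
  by move=> <-; rewrite mulfK // expf_neq0.
split.
- rewrite [LHS](solve _ (b ^+ 2 * (c ^+ 2 * z00 ^+ 2 - a ^+ 2 * z10 ^+ 2))).
    by field.
  by rewrite Q1; ring.
- rewrite [LHS](solve _ (a ^+ 2 * (c ^+ 2 * z01 ^+ 2 - b ^+ 2 * z10 ^+ 2))).
    by field.
  by rewrite Q2; ring.
- rewrite [LHS](solve _ (c ^+ 2 * (a ^+ 2 * z01 ^+ 2 - b ^+ 2 * z00 ^+ 2))).
    by field.
  by rewrite Q3; ring.
Qed.

End LaxCoefficients.
End ThetaConstantsFinal.

Local Close Scope classical_set_scope.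

Theorem mainTheorem6 (R : realType) (A : comAlgType R[i])
    (s0 s1 s2 s3 : A) (br1 br2 br3 : A -> A -> A)
    (tau u v : R[i]) :
  0 < complex.Im tau ->
  linear_bracket br1 s0 s1 s2 s3 ->
  quadratic_bracket tau br2 s0 s1 s2 s3 ->
  cubic_bracket tau br3 s0 s1 s2 s3 ->
  theta 1 1 u tau != 0 ->
  theta 1 1 v tau != 0 ->
  let L := Lax tau s0 s1 s2 s3 in
  let I2 := constmx A (sigma0 R) in
  let S := L u *t I2 + I2 *t L v - s0 *: (I2 *t I2) in
  tens_bracket br3 (L u) (L v)
    = (1 / 2 : R[i])%:A *: anticomm (tens_bracket br2 (L u) (L v)) S
  /\
  tens_bracket br2 (L u) (L v)
    = (1 / 2 : R[i])%:A *: anticomm (tens_bracket br1 (L u) (L v)) S.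
Proof.
move=> tau0 lin quad cub u0 v0; apply: Lax_recursion lin quad cub _.
by move=> z [->|->]; exact: lax_coef_relations.
Qed.
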